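(* Let $X$ and $Z$ be jointly distributed random variables that can be either discrete or continuous, with $Z$ taking values in $\mathsf Z$ and $X$ in $\mathsf X$, and let $$\gamma(x)=\log\frac{\sup_{z\in\mathsf Z}P_{Z|X=x}(z)}{\inf_{z\in\mathsf Z}P_{Z|X=x}(z)}.$$ Then $$I(X;Z)\le\min\Big\{\sqrt{\tfrac12\,\mathbb E[\gamma^2(X)]\,L(X;Z)},\ \tfrac12\,\mathbb E[\gamma^2(X)]\Big\},$$ where $L(X;Z)=D(P_XP_Z\|P_{X,Z})$. Moreover, $$I(X;Z)\le\Big(\sup_{x\in\mathsf X}\gamma(x)\Big)\int_{\mathsf X}d_{\rm TV}(P_{Z|X=x},P_Z)\,P_X(\mathrm dx).$$
   Context: $P_{Z|X=x}(z)$ denotes the conditional PMF (discrete $Z$) or PDF (continuous $Z$) of $Z$ given $X=x$ on the space $\mathsf Z$. $I(X;Z)=D(P_{X,Z}\|P_XP_Z)$ is the mutual information, $D(\cdot\|\cdot)$ is the KL divergence (natural logarithms), $L(X;Z)$ is the Lautum information, and $d_{\rm TV}(P,Q)=\frac12\int|P-Q|(\mathrm dz)$. The value $\gamma(x)=+\infty$ is allowed when the infimum is $0$, in which case a bound whose right-hand side is infinite is vacuous. *)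

(* Defs.v *)
From HB Require Import structures.
From mathcomp Require Import all_boot all_order all_algebra.
From mathcomp Require Import all_classical all_reals all_analysis measurable_realfun.

Set Implicit Arguments.
Unset Strict Implicit.
Unset Printing Implicit Defensive.

Import Order.TTheory GRing.Theory Num.Theory.
Local Open Scope classical_set_scope.
Local Open Scope ring_scope.
Local Open Scope ereal_scope.
Local Open Scope charge_scope.

(* D(P || Q) is the P-integral of log (dP/dQ) when P is absolutely continuous
   with respect to Q, and +oo otherwise; natural logarithms.  The value
   lne 0 = -oo only occurs on a P-null set. *)
Definition kl_divergence {d} {T : measurableType d} {R : realType}
    (P Q : probability T R) : \bar R :=
  if `[< P `<< Q >]
  then \int[P]_t lne (('d (charge_of_finite_measure P) '/d Q) t)
  else +oo.

Section total_variation.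
Context {d : measure_display} {T : measurableType d} {R : realType}.

Definition charge_diff (P Q : probability T R) : {charge set T -> \bar R} :=
  cadd (charge_of_finite_measure P) (cscale (-1) (charge_of_finite_measure Q)).

(* The variation measure |P - Q|; it does not depend on the Hahn
   decomposition that is picked. *)
Definition abs_diff (P Q : probability T R) : set T -> \bar R :=
  charge_variation
    (svalP (cid (svalP (cid (Hahn_decomposition (charge_diff P Q)))))).

Definition d_TV (P Q : probability T R) : \bar R :=
  (2^-1)%:E * abs_diff P Q [set: T].

End total_variation.

Section joint_law.
Context {d dX dZ : measure_display} {Omega : measurableType d}
  {TX : measurableType dX} {TZ : measurableType dZ} {R : realType}
  {P : probability Omega R}.
Variables (X : {RV P >-> TX}) (Z : {RV P >-> TZ}).

Definition rv_pair (w : Omega) : TX * TZ := (X w, Z w).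

Let measurable_rv_pair : measurable_fun [set: Omega] rv_pair.
Proof. by apply: measurable_fun_pair; exact: measurable_funPT. Qed.

HB.instance Definition _ :=
  isMeasurableFun.Build _ _ _ _ rv_pair measurable_rv_pair.

Definition joint_law : probability (TX * TZ)%type R := distribution P rv_pair.

Definition product_law : probability (TX * TZ)%type R :=
  distribution P X \x distribution P Z.

Definition mutual_information : \bar R := kl_divergence joint_law product_law.

Definition lautum_information : \bar R := kl_divergence product_law joint_law.

(* k x is a version of the law of Z given X = x, for x in the space SX where
   X takes its values. *)
Definition conditional_law (SX : set TX) (k : TX -> probability TZ R) : Prop :=
  (forall B, measurable B -> measurable_fun SX (fun x => k x B)) /\
  (forall A B, measurable A -> measurable B ->
    P (X @^-1` A `&` Z @^-1` B) =
    \int[distribution P X]_(x in SX `&` A) k x B).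

End joint_law.

Section conditional_density.
Context {dX dZ : measure_display} {TX : measurableType dX}
  {TZ : measurableType dZ} {R : realType}.

(* p x is the density on SZ of the law k x with respect to nu.  With the
   counting measure on a countable SZ it is the PMF z |-> k x [set z]; with
   Lebesgue measure on a measurable subset SZ of a Euclidean space it is the
   PDF. *)
Definition conditional_density (SX : set TX) (SZ : set TZ)
    (nu : {measure set TZ -> \bar R}) (k : TX -> probability TZ R)
    (p : TX -> TZ -> R) : Prop :=
  [/\ measurable_fun (SX `*` SZ) (fun xz : TX * TZ => p xz.1 xz.2),
      forall x z, SX x -> SZ z -> (0 <= p x z)%R &
      forall x B, SX x -> measurable B ->
        k x B = \int[nu]_(z in B `&` SZ) (p x z)%:E].

(* The conventions r / 0 = +oo for r > 0 and lne +oo = +oo give the value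
   +oo when the infimum is 0 or the supremum is infinite. *)
Definition gamma (SZ : set TZ) (p : TX -> TZ -> R) (x : TX) : \bar R :=
  lne (ereal_sup [set (p x z)%:E | z in SZ] /
       ereal_inf [set (p x z)%:E | z in SZ]).

End conditional_density.

(* Main.v *)
(* Write Q for the law of Z, p_x for the conditional density, q for the density
   of Q, r(x,z) = p_x(z) / q(z) for the density of the joint law with respect to
   the product law pi, and g(x) for the oscillation of log p_x.

   Since (r - 1) log r >= 0 and r - 1 has both marginal integrals equal to 0,
   the terms depending on x only or on z only can be dropped from
   log r = log p_x - log q, which gives
     I <= int (r - 1) log r dpi = int (r - 1) (log p_x - c(x)) dpi
       <= 1/2 int g(x) |r - 1| dpi,
   where c(x) is the midpoint of the range of log p_x. This is already the total
   variation bound. A Pinsker-type inequality (r - 1)^2 <= W(r) phi(r), where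
   the weight W is affine with W(1) = 2 and phi is r log r - r + 1 or
   r - 1 - log r, combined with the AM-GM inequality, bounds the right-hand side
   by t/2 E[g^2] + D/(4t) for all t > 0, where D is I or L. Taking D = I and
   t = 1/2 gives I <= 1/2 E[g^2]; taking D = L and the optimal t gives the
   other bound.

   The suprema over z in gamma need not be measurable in x, and for a
   nonmeasurable integrand the integral of the library is a lower integral; so
   g is taken to be the oscillation between the Q-essential bounds of p_x, which
   is measurable and at most gamma. *)
Require Import Defs.
From HB Require Import structures.
From mathcomp Require Import all_boot all_order all_algebra.
From mathcomp Require Import all_classical all_reals all_analysis measurable_realfun.
From mathcomp Require Import ess_sup_inf.
From mathcomp Require Import ring lra.
Set Implicit Arguments.
Unset Strict Implicit.
Unset Printing Implicit Defensive.
Import Order.TTheory GRing.Theory Num.Theory.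
Import numFieldNormedType.Exports.
Local Open Scope classical_set_scope.
Local Open Scope ring_scope.
Local Open Scope ereal_scope.

(** * Logarithmic inequalities *)

Section log_inequalities.
Variable R : realType.
Local Open Scope ring_scope.
Implicit Types (x r t : R) (f df : R -> R).

Lemma derive_mean_value f df (x y : R) : 0 < x -> x <= y ->
  (forall t, 0 < t -> is_derive t 1 f (df t)) ->
  exists2 c, x <= c <= y & f y - f x = df c * (y - x).
Proof.
move=> x0 xy fdf.
have [c] := @MVT_segment R f df x y xy
  (fun t => ltac:(move=> /[!in_itv]/= /andP[xt _]; exact: fdf (lt_trans x0 xt)))
  ltac:(apply: derivable_within_continuous => t /[!in_itv]/= /andP[xt _];
        apply: ex_derive; exact: fdf (lt_le_trans x0 xt)).
by rewrite in_itv/= => cxy ->; exists c.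
Qed.

Lemma ge0_of_derive f df : f 1 = 0 ->
  (forall t, 0 < t -> is_derive t 1 f (df t)) ->
  (forall t, 1 <= t -> 0 <= df t) -> (forall t, 0 < t <= 1 -> df t <= 0) ->
  forall x, 0 < x -> 0 <= f x.
Proof.
move=> f1 fdf dfge dfle x x0; have [x1|x1] := leP 1 x.
  have [c /andP[c1 _]] := derive_mean_value ltr01 x1 fdf.
  by rewrite f1 subr0 => ->; rewrite mulr_ge0 ?subr_ge0 ?dfge.
have [c /andP[xc c1]] := derive_mean_value x0 (ltW x1) fdf.
rewrite f1 sub0r => /eqP; rewrite eqr_oppLR => /eqP ->.
by rewrite -mulNr mulr_ge0 ?subr_ge0 ?(ltW x1)// oppr_ge0 dfle// c1 (lt_le_trans x0).
Qed.

Lemma ln_le_subr1 t : 0 < t -> ln t <= t - 1.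
Proof.
by move=> t0; have := @le_ln1Dx R (t - 1); rewrite [(1 + _)%R]addrC subrK; apply; lra.
Qed.

Lemma ln_ge_1subV t : 0 < t -> 1 - t^-1 <= ln t.
Proof.
move=> t0; have := @ln_le_subr1 t^-1; rewrite invr_gt0 lnV// => /(_ t0); lra.
Qed.

(** Up to the factor 4/3, the derivative of the difference of the two sides in [sqr_subr1_le_xlnx].
    It is nondecreasing and vanishes at 1, which fixes its sign on either side of 1. *)
Let k t := (t + 1) * ln t - 2 * (t - 1).

Let k_derive t : 0 < t -> is_derive t 1 k (ln t + t^-1 - 1).
Proof.
move=> t0; have dln := is_derive1_ln t0; rewrite /k.
apply: is_derive_eq; rewrite /GRing.scale/= /k; field; lra.
Qed.

Let k_mono x y : 0 < x -> x <= y -> k x <= k y.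
Proof.
move=> x0 xy; have [c /andP[xc _]] := derive_mean_value x0 xy k_derive.
have c0 := lt_le_trans x0 xc; rewrite -subr_ge0 => ->.
by rewrite mulr_ge0 ?subr_ge0//; have := ln_ge_1subV c0; lra.
Qed.

Let k1 : k 1 = 0. Proof. by rewrite /k ln1; ring. Qed.

(* The second derivative of the difference of both sides at r is a positive
   multiple of ln r + r^-1 - 1. *)
Lemma sqr_subr1_le_xlnx r : 0 <= r ->
  (r - 1) ^+ 2 <= (4/3 + 2/3 * r) * (r * ln r - r + 1).
Proof.
rewrite le_eqVlt => /predU1P[<-|r0]; first by rewrite ln0//; lra.
rewrite -subr_ge0; pose f t := (4/3 + 2/3 * t) * (t * ln t - t + 1) - (t - 1) ^+ 2.
rewrite -[leRHS]/(f r); apply: (@ge0_of_derive f (fun t => 4/3 * k t)) r0.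
- by rewrite /f ln1; ring.
- move=> t t0; have dln := is_derive1_ln t0; rewrite /f.
  apply: is_derive_eq; rewrite /GRing.scale/= /k; field; lra.
- by move=> t t1; have := k_mono ltr01 t1; rewrite k1; lra.
- by move=> t /andP[t0 t1]; have := k_mono t0 t1; rewrite k1; lra.
Qed.

(** The previous inequality at [r^-1], multiplied by [r ^+ 2]; this exchanges the two coefficients
    of the weight. *)
Lemma sqr_subr1_le_subln r : 0 < r ->
  (r - 1) ^+ 2 <= (2/3 + 4/3 * r) * (r - 1 - ln r).
Proof.
move=> r0; have := @sqr_subr1_le_xlnx r^-1; rewrite invr_ge0 lnV// => /(_ (ltW r0)).
rewrite -(ler_pM2l (exprn_gt0 2 r0)).
rewrite [leLHS](_ : _ = (r - 1) ^+ 2); last by field; lra.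
by rewrite [leRHS](_ : _ = (2/3 + 4/3 * r) * (r - 1 - ln r)); last by field; lra.
Qed.

(** Both factors change sign at 1; the endpoint 0 is covered by the convention [ln 0 = 0]. *)
Lemma subr1_mul_ln_ge0 r : 0 <= r -> 0 <= (r - 1) * ln r.
Proof.
rewrite le_eqVlt => /predU1P[<-|r0]; first by rewrite ln0// mulr0.
have [r1|r1] := leP 1 r; first by rewrite mulr_ge0 ?subr_ge0 ?ln_ge0.
by rewrite mulr_le0 ?ln_le0 ?subr_le0 // ltW.
Qed.

Lemma xlnx_ge r : 0 <= r -> r - 1 <= r * ln r.
Proof.
rewrite le_eqVlt => /predU1P[<-|r0]; first by rewrite mul0r; lra.
have := ln_ge_1subV r0; rewrite -(ler_pM2l r0) mulrBr mulr1 mulfV//; lra.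
Qed.

End log_inequalities.

(** * Densities and Kullback-Leibler divergence *)

Section density.
Local Open Scope charge_scope.
Context {d : measure_display} {T : measurableType d} {R : realType}.
Variables (nu : {finite_measure set T -> \bar R})
  (mu : {sigma_finite_measure set T -> \bar R}) (r : T -> R).
Hypotheses (mr : measurable_fun [set: T] r) (r0 : forall x, (0 <= r x)%R)
  (nuE : forall A, measurable A -> nu A = \int[mu]_(x in A) (r x)%:E).

Lemma density_dominates : nu `<< mu.
Proof.
apply/null_content_dominatesP => A mA muA; rewrite nuE//.
by apply: null_set_integral => //; apply/measurable_EFinP/measurable_funTS.
Qed.

Lemma density_integrable : mu.-integrable [set: T] (EFin \o r).
Proof.
apply/integrableP; split; first exact/measurable_EFinP.
under eq_integral do rewrite /= ger0_norm//.
by rewrite -nuE// ltey_eq fin_num_measure.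
Qed.

Lemma density_Radon_Nikodym :
  ae_eq mu [set: T] (EFin \o r) ('d (charge_of_finite_measure nu) '/d mu).
Proof.
apply: integral_ae_eq => //; first exact: density_integrable.
- exact/measurable_int/Radon_Nikodym_integrable/density_dominates.
- move=> E _ mE; rewrite -Radon_Nikodym_integral//; last exact: density_dominates.
  by rewrite /= -nuE.
Qed.

Lemma ge0_integral_density (f : T -> \bar R) :
  measurable_fun [set: T] f -> (forall x, 0 <= f x) ->
  \int[nu]_x f x = \int[mu]_x (f x * (r x)%:E).
Proof.
move=> mf f0; have numu := density_dominates.
have mg := measurable_int _ (Radon_Nikodym_SigmaFinite.f_integrable numu).
rewrite -(Radon_Nikodym_SigmaFinite.change_of_variables numu)//.
apply: ae_eq_integral => //; first exact: emeasurable_funM.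
  by apply: emeasurable_funM => //; exact/measurable_EFinP.
have := ae_eq_Radon_Nikodym_SigmaFinite numu measurableT.
have := density_Radon_Nikodym.
by apply: filterS2 => x /(_ I)/= rE /(_ I) -> _; rewrite rE.
Qed.

Lemma integral_density (f : T -> \bar R) :
  measurable_fun [set: T] f -> \int[nu]_x f x = \int[mu]_x (f x * (r x)%:E).
Proof.
move=> mf; rewrite [LHS]integralE [RHS]integralE; congr (_ - _).
- rewrite ge0_integral_density//; last exact: measurable_funepos.
  by apply: eq_integral => x _; rewrite !funeposE maxe_pMl ?lee_fin// mul0e.
- rewrite ge0_integral_density//; last exact: measurable_funeneg.
  by apply: eq_integral => x _; rewrite !funenegE maxe_pMl ?lee_fin// mul0e mulNe.
Qed.

End density.

Lemma measurable_lne (R : realType) : measurable_fun [set: \bar R] (@lne R).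
Proof.
rewrite (_ : @lne R = fun x => if x <= 0 then -oo else
    if x == +oo then +oo else (ln (fine x))%:E); last first.
  by apply/funext => -[r| |]//; rewrite leNye.
apply: measurable_fun_ifT => //; first exact: measurable_fun_lee.
apply: measurable_fun_ifT => //; first exact: measurable_fun_eqe.
apply/measurable_EFinP; apply: measurableT_comp; first exact: measurable_ln.
exact: fine_measurable.
Qed.

Section kl_density.
Local Open Scope charge_scope.
Context {d : measure_display} {T : measurableType d} {R : realType}.
Variables (P Q : probability T R) (r : T -> R).
Hypotheses (mr : measurable_fun [set: T] r) (r0 : forall x, (0 <= r x)%R)
  (PE : forall A, measurable A -> P A = \int[Q]_(x in A) (r x)%:E).

Lemma kl_divergence_density :
  kl_divergence P Q = \int[Q]_x (r x * ln (r x))%:E.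
Proof.
have PQ := density_dominates mr PE.
have mRN : measurable_fun [set: T] ('d (charge_of_finite_measure P) '/d Q).
  exact/measurable_int/Radon_Nikodym_integrable.
rewrite /kl_divergence; case: ifPn => [_|/asboolPn//].
have mlne := measurableT_comp (@measurable_lne R) mRN.
rewrite (integral_density mr r0 PE)//.
apply: ae_eq_integral => //.
- by apply: emeasurable_funM => //; exact/measurable_EFinP.
- apply/measurable_EFinP/measurable_funM => //.
  exact: measurableT_comp (@measurable_ln R) mr.
have := density_Radon_Nikodym mr r0 PE.
apply: filterS => x /(_ I)/= <- _.
(* Where [r x = 0] the logarithm [lne] is [-oo], but the factor [r x] makes both integrands 0. *)
have := r0 x; rewrite le_eqVlt => /predU1P[<-|rx]; first by rewrite mule0 mul0r.
by rewrite lne_EFin// -EFinM mulrC.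
Qed.

(** A finite divergence forces [Q] to be absolutely continuous with respect to [P]. The chain rule
    then gives dQ/dP * r = 1 almost everywhere, so [r] is positive there and the logarithm of dQ/dP
    is [- ln r]. *)
Lemma kl_divergence_density_rev : kl_divergence Q P < +oo ->
  {ae Q, forall x, (0 < r x)%R} /\
  kl_divergence Q P = \int[Q]_x (- ln (r x))%:E.
Proof.
rewrite /kl_divergence; case: ifPn => [/asboolP QP _|//].
have PQ := density_dominates mr PE.
have mRN : measurable_fun [set: T] ('d (charge_of_finite_measure Q) '/d P).
  exact/measurable_int/Radon_Nikodym_integrable.
have RN1 : {ae Q, forall x, 'd (charge_of_finite_measure Q) '/d P x * (r x)%:E = 1}.
  have := @Radon_Nikodym_chain_rule _ _ _ (charge_of_finite_measure Q) Q P QP PQ.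
  have := @density_Radon_Nikodym _ _ _ Q Q (cst 1%R) (measurable_cst _) _ _.
  have := density_Radon_Nikodym mr r0 PE.
  move=> h /(_ (fun=> ler01)).
  move=> /(_ (fun A mA => esym (etrans (integral_cst Q mA 1) (mul1e _)))).
  move: h; apply: filterS3 => x /(_ I)/= <- /(_ I)/= <- /(_ I) ->.
  by [].
have r_gt0 : {ae Q, forall x, (0 < r x)%R}.
  apply: filterS RN1 => x; rewrite lt_neqAle r0 andbT => h.
  by apply: contraPN h => /eqP <-; rewrite mule0 => /esym/eqP; rewrite onee_eq0.
split=> //; apply: ae_eq_integral => //.
- exact: measurableT_comp (@measurable_lne R) mRN.
- apply/measurable_EFinP/measurableT_comp => //.
  exact: measurableT_comp (@measurable_ln R) mr.
move: RN1 r_gt0; apply: filterS2 => x + rx _.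
have /fineK <- := @Radon_Nikodym_fin_num _ _ _ (charge_of_finite_measure Q) P x QP.
move=> [srx].
have -> : fine ('d (charge_of_finite_measure Q) '/d P x) = ((r x)^-1)%R.
  by rewrite -[LHS](mulfK (lt0r_neq0 rx)) srx mul1r.
by rewrite lneV// lne_EFin.
Qed.

End kl_density.

(** * Integrals on product spaces *)

Lemma integral_cst_probability {d} {T : measurableType d} {R : realType}
  (P : probability T R) (c : R) : \int[P]_x c%:E = c%:E.
Proof. by rewrite integral_cst// [X in _ * X]probability_setT mule1. Qed.

Section ae_lemmas.
Context {d : measure_display} {T : measurableType d} {R : realType}.
Variable mu : {measure set T -> \bar R}.

Lemma ae_le_integrable (f g : T -> \bar R) : measurable_fun [set: T] f ->
  {ae mu, forall x, `|f x| <= `|g x|} ->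
  mu.-integrable [set: T] g -> mu.-integrable [set: T] f.
Proof.
move=> mf fg /integrableP[mg goo]; apply/integrableP; split=> //.
apply: le_lt_trans goo; apply: ae_ge0_le_integral => //.
- exact: measurableT_comp.
- exact: measurableT_comp.
- by apply: filterS fg.
Qed.

Lemma ae_le_integral (f g : T -> \bar R) : {ae mu, forall x, f x <= g x} ->
  mu.-integrable [set: T] f -> mu.-integrable [set: T] g ->
  \int[mu]_x f x <= \int[mu]_x g x.
Proof.
move=> fg fi gi.
have mf := measurable_int _ fi; have mg := measurable_int _ gi.
(* Replacing [f] by its minimum with [g] turns the almost sure inequality into a pointwise one. *)
rewrite (@ae_eq_integral _ _ _ mu _ (fun x => mine (f x) (g x)))//; last 2 first.
- exact: measurable_mine.
- by apply: filterS fg => x fgx _; apply/esym/min_idPl.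
apply: le_integral => //; last by move=> x _; rewrite ge_min lexx orbT.
apply: ae_le_integrable fi; first exact: measurable_mine.
by apply: filterS fg => x /min_idPl ->.
Qed.

End ae_lemmas.

Section product_integrals.
Context {d1 d2 : measure_display} {T1 : measurableType d1}
  {T2 : measurableType d2} {R : realType}.
Variables (m1 : {sigma_finite_measure set T1 -> \bar R})
  (m2 : {sigma_finite_measure set T2 -> \bar R}).

(** The measure of the complement is the integral of the measures of its sections, almost all of
    which are 0. *)
Lemma ae_product (A : set (T1 * T2)) : measurable A ->
  {ae m1, forall x, {ae m2, forall z, A (x, z)}} ->
  {ae m1 \x m2, forall xz, A xz}.
Proof.
move=> mA h; exists (~` A); split => //; first exact: measurableC.
have mCA := measurableC mA.
rewrite [LHS](_ : _ = \int[m1]_x (m2 \o xsection (~` A)) x)//.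
rewrite (@ae_eq_integral _ _ _ m1 _ (cst 0)) ?integral0//.
  exact: measurable_fun_xsection.
apply: filterS h => x hx _ /=.
apply: measure_negligible; first exact: measurable_xsection.
by apply: negligibleS hx => z; rewrite /xsection/= inE.
Qed.

Lemma measurable_integral_section (h : T1 * T2 -> R) (B : set T2) :
  measurable B -> measurable_fun [set: T1 * T2] h -> (forall xz, 0 <= h xz)%R ->
  measurable_fun [set: T1] (fun x => \int[m2]_(z in B) (h (x, z))%:E).
Proof.
move=> mB mh h0.
rewrite (_ : (fun _ => _) = fun x => \int[m2]_z
    ((EFin \o h) \_ ([set: T1] `*` B)) (x, z)); last first.
  apply/funext => x; rewrite integral_mkcond; apply: eq_integral => z _.
  by rewrite !patchE in_setX/= in_setT.
apply: (@measurable_fun_fubini_tonelli_F _ _ _ _ _ m2).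
  apply: (measurable_restrictT _ _).1; first exact: measurableX.
  by apply: measurable_funTS; exact/measurable_EFinP.
by move=> xz; rewrite patchE; case: ifPn => // _; rewrite lee_fin.
Qed.

Lemma ge0_integral_product_weight (F : T1 -> R) (h : T1 * T2 -> R) (c : R) :
  measurable_fun [set: T1] F -> (forall x, 0 <= F x)%R ->
  measurable_fun [set: T1 * T2] h -> (forall xz, 0 <= h xz)%R ->
  {ae m1, forall x, \int[m2]_z (h (x, z))%:E = c%:E} ->
  \int[m1 \x m2]_xz (F xz.1 * h xz)%:E = \int[m1]_x (F x * c)%:E.
Proof.
move=> mF F0 mh h0 hc.
have mFh : measurable_fun [set: T1 * T2] (fun xz => (F xz.1 * h xz)%:E).
  by apply/measurable_EFinP/measurable_funM => //; exact: measurableT_comp.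
rewrite fubini_tonelli1//; last by move=> xz; rewrite lee_fin mulr_ge0.
apply: ae_eq_integral => //.
- by apply: measurable_fun_fubini_tonelli_F => // xz; rewrite lee_fin mulr_ge0.
- by apply/measurable_EFinP/measurable_funM.
apply: filterS hc => x hx _; rewrite /fubini_F/=.
under eq_integral do rewrite EFinM.
rewrite ge0_integralZl//; last by rewrite lee_fin.
- by rewrite hx.
- by apply/measurable_EFinP; exact: measurableT_comp mh (pair1_measurable x).
- by move=> z _; rewrite lee_fin.
Qed.

(** This is what removes a term in [x] alone from an integral against r - 1. Since [F] may be
    unbounded, integrability of the product is a separate hypothesis. *)
Lemma integral_product_weight0 (F : T1 -> R) (w : T1 * T2 -> R) :
  (m1 \x m2).-integrable [set: T1 * T2] (EFin \o w) ->
  (m1 \x m2).-integrable [set: T1 * T2] (fun xz => (w xz * F xz.1)%:E) ->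
  {ae m1, forall x, \int[m2]_z (w (x, z))%:E = 0} ->
  \int[m1 \x m2]_xz (w xz * F xz.1)%:E = 0.
Proof.
move=> wi wFi w0; rewrite -integral12_prod_meas1//.
rewrite (@ae_eq_integral _ _ _ m1 _ (cst 0)) ?integral0//.
  exact: measurable_fubini_F wFi.
have := ae_integrable1 wi; move: w0; apply: filterS2 => x wx0 wxi _.
rewrite /fubini_F/=; under eq_integral do rewrite EFinM.
by rewrite integralZr// wx0 mul0e.
Qed.

Lemma integral_product_weight0_r (F : T2 -> R) (w : T1 * T2 -> R) :
  (m1 \x m2).-integrable [set: T1 * T2] (EFin \o w) ->
  (m1 \x m2).-integrable [set: T1 * T2] (fun xz => (w xz * F xz.2)%:E) ->
  {ae m2, forall z, \int[m1]_x (w (x, z))%:E = 0} ->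
  \int[m1 \x m2]_xz (w xz * F xz.2)%:E = 0.
Proof.
move=> wi wFi w0; rewrite -integral21_prod_meas1//.
rewrite (@ae_eq_integral _ _ _ m2 _ (cst 0)) ?integral0//.
  exact: measurable_fubini_G wFi.
have := ae_integrable2 wi; move: w0; apply: filterS2 => x wx0 wxi _.
rewrite /fubini_G/=; under eq_integral do rewrite EFinM.
by rewrite integralZr// wx0 mul0e.
Qed.

End product_integrals.

(** * Bounds in terms of the oscillation of the logarithm *)

Section log_oscillation.
Context {dX dZ : measure_display} {TX : measurableType dX}
  {TZ : measurableType dZ} {R : realType}.
Variables (PX : probability TX R) (Q : probability TZ R) (r : TX * TZ -> R).
Hypotheses (mr : measurable_fun [set: TX * TZ] r) (r0 : forall xz, (0 <= r xz)%R)
  (marg1 : {ae PX, forall x, \int[Q]_z (r (x, z))%:E = 1})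
  (marg2 : {ae Q, forall z, \int[PX]_x (r (x, z))%:E = 1}).
Local Notation pi := (PX \x Q).

Let mrx x : measurable_fun [set: TZ] (fun z => r (x, z)).
Proof. exact: measurableT_comp mr (pair1_measurable x). Qed.

Let mrz z : measurable_fun [set: TX] (fun x => r (x, z)).
Proof. exact: measurableT_comp mr (pair2_measurable z). Qed.

Lemma marginal1_affine (a b : R) : (0 <= a)%R -> (0 <= b)%R ->
  {ae PX, forall x, \int[Q]_z (a + b * r (x, z))%:E = (a + b)%:E}.
Proof.
move=> a0 b0; apply: filterS marg1 => x hx.
under eq_integral do rewrite EFinD EFinM.
rewrite ge0_integralD//; last 2 first.
- by move=> z _; rewrite mule_ge0 ?lee_fin.
- exact/measurable_funeM/measurable_EFinP.
rewrite integral_cst_probability ge0_integralZl ?lee_fin//; last 2 first.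
- exact/measurable_EFinP.
- by move=> z _; rewrite lee_fin.
by rewrite hx mule1.
Qed.

Lemma density_integrable_product : pi.-integrable [set: TX * TZ] (EFin \o r).
Proof.
apply/integrableP; split; first exact/measurable_EFinP.
under eq_integral => xz _ do rewrite /= ger0_norm// -[r xz]mul1r.
rewrite (@ge0_integral_product_weight _ _ _ _ _ PX Q (cst 1%R) r 1)//.
by rewrite /cst/= mul1r integral_cst_probability ltry.
Qed.

Let w xz := (r xz - 1)%R.

Let mw : measurable_fun [set: TX * TZ] w.
Proof. exact: measurable_funB. Qed.

Let iw : pi.-integrable [set: TX * TZ] (EFin \o w).
Proof.
rewrite (_ : EFin \o w = (EFin \o r) \- (EFin \o cst 1%R)); last first.
  by apply/funext => xz; rewrite /= EFinB.
apply: integrableB => //; first exact: density_integrable_product.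
exact: (finite_measure_integrable_cst (PX \x Q : probability _ _) 1 measurableT).
Qed.

Let w1 : {ae PX, forall x, \int[Q]_z (w (x, z))%:E = 0}.
Proof.
apply: filterS marg1 => x hx; rewrite /w.
rewrite integralB_EFin//; last 2 first.
- apply/integrableP; split; first exact/measurable_EFinP.
  by under eq_integral do rewrite /= ger0_norm//; rewrite hx ltry.
- exact: finite_measure_integrable_cst.
by rewrite hx integral_cst_probability subee.
Qed.

Let w2 : {ae Q, forall z, \int[PX]_x (w (x, z))%:E = 0}.
Proof.
apply: filterS marg2 => z hz; rewrite /w.
rewrite integralB_EFin//; last 2 first.
- apply/integrableP; split; first exact/measurable_EFinP.
  by under eq_integral do rewrite /= ger0_norm//; rewrite hz ltry.
- exact: finite_measure_integrable_cst.
by rewrite hz integral_cst_probability subee.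
Qed.

Lemma integral_density_subr1 : \int[pi]_xz (w xz)%:E = 0.
Proof.
have := @integral_product_weight0 _ _ _ _ _ PX Q (cst 1%R) w iw _ w1.
by under eq_integral do rewrite mulr1; apply; under eq_fun do rewrite mulr1.
Qed.

(** * The oscillation bound when 0 lies between [alpha] and [beta] *)

Section normalized.
Variables (alpha beta : TX -> R) (b : TZ -> R).
Hypotheses (mal : measurable_fun [set: TX] alpha)
  (mbe : measurable_fun [set: TX] beta) (mb : measurable_fun [set: TZ] b)
  (env : {ae pi, forall xz, [/\ 0 < r xz, alpha xz.1 <= 0 <= beta xz.1 &
     alpha xz.1 <= ln (r xz) + b xz.2 <= beta xz.1]%R})
  (ig : PX.-integrable [set: TX] (fun x => (beta x - alpha x)%:E)).

(** In the application [b] is log q, so [ln r + b] is log p_x and [a] is the midpoint c(x). The sets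
    [B n] truncate [b], whose product with [w] is not assumed integrable. *)
Let g x := (beta x - alpha x)%R.
Let h xz := (w xz * (ln (r xz) + b xz.2))%R.
Let a x := ((alpha x + beta x) / 2)%R.
Let B n := [set xz : TX * TZ | (`|b xz.2| <= n%:R)%R].

Let mg1 : measurable_fun [set: TX * TZ] (fun xz => g xz.1).
Proof. by apply: measurableT_comp => //; exact: measurable_funB. Qed.

Let mb2 : measurable_fun [set: TX * TZ] (fun xz => b xz.2).
Proof. exact: measurableT_comp. Qed.

Let mlnr : measurable_fun [set: TX * TZ] (fun xz => ln (r xz)).
Proof. exact: measurableT_comp (@measurable_ln R) mr. Qed.

Let ma1 : measurable_fun [set: TX * TZ] (fun xz => a xz.1).
Proof.
apply: measurableT_comp => //; apply: measurable_funM => //.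
exact: measurable_funD.
Qed.

Let mh : measurable_fun [set: TX * TZ] h.
Proof. by apply: measurable_funM => //; exact: measurable_funD. Qed.

Let iG : pi.-integrable [set: TX * TZ] (fun xz => (`|g xz.1| * (1 + 1 * r xz))%:E).
Proof.
apply/integrableP; split.
  apply/measurable_EFinP/measurable_funM; first exact: measurableT_comp.
  by apply: measurable_funD => //; exact: measurable_funM.
under eq_integral => xz _ do
  rewrite /= ger0_norm ?mulr_ge0 ?addr_ge0 ?mulr_ge0//.
rewrite (@ge0_integral_product_weight _ _ _ _ _ PX Q (fun x => `|g x|)%R
  (fun xz => 1 + 1 * r xz)%R (1 + 1))//.
- under eq_integral do rewrite EFinM.
  rewrite ge0_integralZr//; last first.
    by apply/measurable_EFinP/measurableT_comp => //; exact: measurable_funB.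
  by case/integrableP: ig => _ /= goo; rewrite muleC lte_mul_pinfty// lee_fin.
- by apply: measurableT_comp => //; exact: measurable_funB.
- by apply: measurable_funD => //; exact: measurable_funM.
- by move=> xz; rewrite addr_ge0// mulr_ge0.
- exact: marginal1_affine.
Qed.

Let wle xz : (`|w xz| <= 1 + 1 * r xz)%R.
Proof. by rewrite /w; have := r0 xz; rewrite ler_norml; lra. Qed.

(** The dominating function is that of [iG]. Applied to [ln r + b] and to [a]: both are bounded by
    [g] in absolute value because they lie, together with 0, between [alpha] and [beta]. *)
Let dominated (f : TX * TZ -> R) : measurable_fun [set: TX * TZ] f ->
  {ae pi, forall xz, `|f xz| <= g xz.1}%R ->
  pi.-integrable [set: TX * TZ] (fun xz => (w xz * f xz)%:E).
Proof.
move=> mf fg; apply: ae_le_integrable iG.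
  by apply/measurable_EFinP/measurable_funM.
apply: filterS fg => xz fxz; rewrite /= lee_fin normrM normrM normr_id mulrC.
rewrite ler_pM// ?(le_trans fxz)// ?ler_norm// (le_trans (wle xz))//.
exact: ler_norm.
Qed.

Let ih : pi.-integrable [set: TX * TZ] (EFin \o h).
Proof.
apply: (@dominated (fun xz => ln (r xz) + b xz.2)%R).
  exact: measurable_funD.
by apply: filterS env => xz [_ ? ?]; rewrite /g ler_norml; lra.
Qed.

Let iwa : pi.-integrable [set: TX * TZ] (fun xz => (w xz * a xz.1)%:E).
Proof.
apply: (@dominated (fun xz => a xz.1)) => //.
by apply: filterS env => xz [_ ? ?]; rewrite /g /a ler_norml; lra.
Qed.

Let mB0 n : measurable [set z | `|b z| <= n%:R]%R.
Proof.
rewrite -[X in measurable X]setTI; apply: measurable_fun_le => //.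
exact: measurableT_comp.
Qed.

Let mB n : measurable (B n).
Proof.
rewrite -[B n]setTI; apply: measurable_fun_le => //.
exact: measurableT_comp.
Qed.

Let iwB n : pi.-integrable [set: TX * TZ]
  (fun xz => (w xz * (b xz.2 * \1_[set z | `|b z| <= n%:R] xz.2))%:E)%R.
Proof.
apply: ae_le_integrable (integrableZl measurableT n%:R iw).
  apply/measurable_EFinP/measurable_funM => //.
  apply: measurable_funM => //.
  exact: measurableT_comp (measurable_indic (mB0 n)) measurable_snd.
apply: aeW => xz /=; rewrite lee_fin !normrM [leRHS]mulrC ler_wpM2l//.
rewrite /indic !normr_nat; case: (boolP (xz.2 \in _)) => [|_]; last by rewrite mulr0.
by rewrite inE/= mulr1.
Qed.

(** The two sides differ by the integral of [w] times a bounded function of [z], and [w] integrates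
    to 0 over [x] for almost every [z]. *)
Let integral_B n : \int[pi]_(xz in B n) (w xz * ln (r xz))%:E =
  \int[pi]_(xz in B n) (h xz)%:E.
Proof.
have ihB : pi.-integrable [set: TX * TZ] ((EFin \o h) \_ (B n)).
  apply: (integrable_mkcond _ (mB n)).1.
  exact: (integrableS measurableT (mB n) (@subsetT _ _) ih).
rewrite [LHS]integral_mkcond [RHS]integral_mkcond.
rewrite -[RHS]sube0 -[X in _ - X](@integral_product_weight0_r _ _ _ _ _ PX Q
  (fun z => b z * \1_[set z | `|b z| <= n%:R] z)%R w iw (iwB n) w2).
rewrite -integralB//; apply: eq_integral => xz _.
rewrite /= !patchE /indic; case: ifPn => [|/negP] xzB.
  by rewrite [_ \in _](_ : _ = true) // mulr1 -EFinB /h; congr (_%:E); ring.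
rewrite [_ \in _](_ : _ = false); first by rewrite !mulr0 sube0.
exact/negP.
Qed.

(** Passage to the limit in [integral_B]: monotone convergence on the left, where the integrand is
    nonnegative, and dominated convergence on the right, where [h] is integrable. Thus log q is
    dropped without integrating it separately. *)
Let integral_wln : \int[pi]_xz (w xz * ln (r xz))%:E = \int[pi]_xz (h xz)%:E.
Proof.
have BT : \bigcup_n B n = [set: TX * TZ].
  apply/seteqP; split => // xz _; exists (Num.truncn `|b xz.2|).+1 => //.
  by rewrite /B/= ltW// truncnS_gt.
have mwln : measurable_fun [set: TX * TZ] (fun xz => (w xz * ln (r xz))%:E).
  exact/measurable_EFinP/measurable_funM.
have ndB : nondecreasing_seq B.
  move=> m n mn; apply/subsetPset => xz /= /le_trans; apply.
  by rewrite ler_nat.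
have := @ge0_nondecreasing_set_cvg_integral _ _ _ B
  (fun xz => (w xz * ln (r xz))%:E) pi ndB mB
  (fun n => measurable_funTS mwln) (fun n xz _ => subr1_mul_ln_ge0 (r0 xz)).
rewrite BT => /cvg_lim <-//; apply/cvg_lim => //.
under eq_fun do rewrite integral_B integral_mkcond.
have mh' : measurable_fun [set: TX * TZ] (EFin \o h) by exact/measurable_EFinP.
have cvgB : {ae pi, forall xz, [set: TX * TZ] xz ->
    ((EFin \o h) \_ (B n)) xz @[n --> \oo] --> (EFin \o h) xz}.
  apply: aeW => xz _; apply: cvg_near_cst; near=> n; rewrite patchE mem_set//.
  rewrite /B/=; near: n; exists (Num.truncn `|b xz.2|).+1 => // n /= bn.
  by rewrite (le_trans (ltW (truncnS_gt _)))// ler_nat.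
have domB : {ae pi, forall xz n, [set: TX * TZ] xz ->
    `|((EFin \o h) \_ (B n)) xz| <= (abse \o (EFin \o h)) xz}.
  apply: aeW => xz n _; rewrite patchE; case: ifPn => // _.
  by rewrite abse0 abse_ge0.
have mhB n : measurable_fun [set: TX * TZ] ((EFin \o h) \_ (B n)).
  by apply/(measurable_restrictT _ _).1 => //; exact: measurable_funTS.
by have [] := dominated_convergence measurableT mhB mh' cvgB (integrable_abse ih) domB.
Unshelve. all: by end_near. Qed.

(** Subtracting [w * a], whose integral is 0, leaves [w] times the deviation of [ln r + b] from the
    midpoint, which is at most half of [g]. *)
Let integral_h_le :
  \int[pi]_xz (h xz)%:E <= \int[pi]_xz (2^-1 * (g xz.1 * `|w xz|))%:E.
Proof.
have iwg : pi.-integrable [set: TX * TZ] (fun xz => (2^-1 * (g xz.1 * `|w xz|))%:E).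
  apply: ae_le_integrable iG.
    apply/measurable_EFinP/measurable_funM => //.
    by apply: measurable_funM => //; exact: measurableT_comp.
  apply: aeW => xz; rewrite /= lee_fin !normrM normr_id.
  rewrite -[leRHS]mul1r ler_pM// ?ler_pM//; first by rewrite ger0_norm; lra.
    by rewrite normr_id.
  exact: le_trans (wle xz) (ler_norm _).
rewrite -[leLHS]sube0 -(integral_product_weight0 iw iwa w1) -integralB//.
apply: ae_le_integral => //; last exact: integrableB.
apply: filterS env => xz [_ ? ?]; rewrite /h -EFinB lee_fin -mulrBr.
apply: le_trans (ler_norm _) _; rewrite normrM mulrCA mulrA mulrC ler_wpM2r//.
by rewrite /g /a ler_norml; lra.
Qed.

Lemma integral_xlnx_le_normalized :
  pi.-integrable [set: TX * TZ] (fun xz => (r xz * ln (r xz))%:E) /\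
  \int[pi]_xz (r xz * ln (r xz))%:E <=
  \int[pi]_xz (2^-1 * (g xz.1 * `|w xz|))%:E.
Proof.
have iwln : pi.-integrable [set: TX * TZ] (fun xz => (w xz * ln (r xz))%:E).
  apply/integrableP; split; first exact/measurable_EFinP/measurable_funM.
  under eq_integral => xz _ do rewrite /= ger0_norm ?subr1_mul_ln_ge0//.
  by rewrite integral_wln; exact: integrable_lty ih.
have ir1 : pi.-integrable [set: TX * TZ] (fun xz => (1 + r xz)%:E).
  rewrite (_ : (fun _ => _) = (EFin \o cst 1%R) \+ (EFin \o r)) //.
  apply: integrableD => //; last exact: density_integrable_product.
  exact: (finite_measure_integrable_cst (PX \x Q : probability _ _) 1 measurableT).
have irln : pi.-integrable [set: TX * TZ] (fun xz => (r xz * ln (r xz))%:E).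
  apply: ae_le_integrable (integrableD measurableT iwln ir1).
    exact/measurable_EFinP/measurable_funM.
  (* The domination comes from r - 1 <= r ln r <= (r - 1) ln r + (r - 1). *)
  apply: filterS env => xz [r_gt0 _ _].
  have ? := xlnx_ge (r0 xz); have ? := ln_le_subr1 r_gt0.
  have ? := subr1_mul_ln_ge0 (r0 xz).
  by rewrite -EFinD /= lee_fin [leRHS]ger0_norm ?ler_norml /w; nra.
split=> //; apply: le_trans integral_h_le.
(* The added integral of [w] is 0; pointwise, r ln r = w ln r + ln r <= w ln r + w. *)
rewrite -integral_wln -[leRHS]adde0 -integral_density_subr1 -integralD//.
apply: ae_le_integral => //; last exact: integrableD.
apply: filterS env => xz [r_gt0 _ _]; have ? := ln_le_subr1 r_gt0.
by rewrite -EFinD lee_fin /w; nra.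
Qed.

End normalized.

(** Adding one constant [c] to [alpha], [beta] and [b] preserves the envelope and the oscillation,
    and a suitable [c] brings 0 between the shifted bounds. *)
Lemma integral_xlnx_le (alpha beta : TX -> R) (b : TZ -> R) :
  measurable_fun [set: TX] alpha -> measurable_fun [set: TX] beta ->
  measurable_fun [set: TZ] b ->
  {ae PX, forall x, {ae Q, forall z, (0 < r (x, z))%R /\
     (alpha x <= ln (r (x, z)) + b z <= beta x)%R}} ->
  PX.-integrable [set: TX] (fun x => (beta x - alpha x)%:E) ->
  pi.-integrable [set: TX * TZ] (fun xz => (r xz * ln (r xz))%:E) /\
  \int[pi]_xz (r xz * ln (r xz))%:E <=
  \int[pi]_xz (2^-1 * (`|beta xz.1 - alpha xz.1| * `|w xz|))%:E.
Proof.
move=> mal mbe mb env ig.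
have mEb : measurable_fun [set: TZ] (fun z => (expR (- b z))%:E).
  by apply/measurable_EFinP; apply: measurableT_comp => //; exact: measurableT_comp.
(* Integrating exp (alpha - b) <= r <= exp (beta - b) over z brackets the
   constant ln C between - beta x and - alpha x for almost every x. *)
pose C := \int[Q]_z (expR (- b z))%:E.
have boundC : {ae PX, forall x, (expR (alpha x))%:E * C <= 1 <= (expR (beta x))%:E * C}.
  move: env marg1; apply: filterS2 => x hx rx1; rewrite -rx1.
  have mEbc c : measurable_fun [set: TZ] (fun z => (expR c)%:E * (expR (- b z))%:E).
    exact: measurable_funeM.
  rewrite /C -!ge0_integralZl//; try by [rewrite lee_fin expR_ge0
    | move=> z _; rewrite lee_fin expR_ge0].
  have mrxE : measurable_fun [set: TZ] (fun z => (r (x, z))%:E) by exact/measurable_EFinP.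
  apply/andP; split; apply: ae_ge0_le_integral => //;
    try by move=> z _; rewrite ?mule_ge0 ?lee_fin ?expR_ge0.
    apply: filterS hx => z [rz /andP[ar _]] _.
    rewrite -EFinM -expRD lee_fin -[leRHS](lnK rz) ler_expR; lra.
  apply: filterS hx => z [rz /andP[_ rb]] _.
  rewrite -EFinM -expRD lee_fin -[leLHS](lnK rz) ler_expR; lra.
have C0 : 0 <= C by apply: integral_ge0 => z _; rewrite lee_fin expR_ge0.
(* As [C] does not depend on [x], a single point satisfying the bracket shows that [C] is finite and
   positive. *)
have [x0 /andP[Cx0 x0C]] : exists x, (expR (alpha x))%:E * C <= 1 <= (expR (beta x))%:E * C.
  apply: contrapT => /forallNP noC.
  have : PX [set: TX] = 0.
    apply: measure_negligible => //; apply: negligibleS boundC.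
    by move=> x _ /=; exact: noC.
  by move/eqP; rewrite [X in X == _]probability_setT onee_eq0.
have Cfin : C \is a fin_num.
  rewrite ge0_fin_numE// ltey; apply: contraTN Cx0 => /eqP ->.
  by rewrite gt0_muley ?lte_fin ?expR_gt0.
have Cgt0 : (0 < fine C)%R.
  rewrite lt_neqAle fine_ge0// andbT; apply: contraTN x0C => /eqP C0'.
  by rewrite -(fineK Cfin) -C0' mule0 lee_fin ler10.
pose c := ln (fine C).
have mle (f1 f2 : TX * TZ -> R) : measurable_fun [set: TX * TZ] f1 ->
    measurable_fun [set: TX * TZ] f2 -> measurable [set xz | f1 xz <= f2 xz]%R.
  by move=> ? ?; rewrite -[X in measurable X]setTI; exact: measurable_fun_le.
have mlt (f1 f2 : TX * TZ -> R) : measurable_fun [set: TX * TZ] f1 ->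
    measurable_fun [set: TX * TZ] f2 -> measurable [set xz | f1 xz < f2 xz]%R.
  move=> mf1 mf2; rewrite [X in measurable X](_ : _ = ~` [set xz | f2 xz <= f1 xz]%R).
    by apply: measurableC; exact: mle.
  by apply/seteqP; split=> xz /=; rewrite ltNge => /negP.
have mal1 : measurable_fun [set: TX * TZ] (fun xz => alpha xz.1) by exact: measurableT_comp.
have mbe1 : measurable_fun [set: TX * TZ] (fun xz => beta xz.1) by exact: measurableT_comp.
have mlnb : measurable_fun [set: TX * TZ] (fun xz => ln (r xz) + b xz.2)%R.
  apply: measurable_funD; first exact: measurableT_comp (@measurable_ln R) mr.
  exact: measurableT_comp.
have envc : {ae pi, forall xz, [/\ 0 < r xz, alpha xz.1 + c <= 0 <= beta xz.1 + c &
     alpha xz.1 + c <= ln (r xz) + (b xz.2 + c) <= beta xz.1 + c]%R}.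
  pose A := [set xz | 0 < r xz]%R `&`
    ([set xz | alpha xz.1 + c <= 0]%R `&` [set xz | 0 <= beta xz.1 + c]%R) `&`
    ([set xz | alpha xz.1 <= ln (r xz) + b xz.2]%R `&`
     [set xz | ln (r xz) + b xz.2 <= beta xz.1]%R).
  have AE : {ae pi, forall xz, A xz}.
    apply: ae_product.
      apply: measurableI; first apply: measurableI; first exact: mlt.
        by apply: measurableI; apply: mle => //; exact: measurable_funD.
      by apply: measurableI; exact: mle.
    move: env boundC; apply: filterS2 => x hx /andP[Cx xC].
    apply: filterS hx => z [rz /andP[ar rb]]; split; split=> //; split=> /=.
      have : (expR (alpha x + c) <= 1)%R.
        by rewrite expRD lnK ?posrE// -lee_fin EFinM fineK.
      by rewrite expR_le1.
    have : (1 <= expR (beta x + c))%R.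
      by rewrite expRD lnK ?posrE// -lee_fin EFinM fineK.
    by rewrite -[X in (X <= _)%R -> _]expR0 ler_expR.
  apply: filterS AE => xz [[rz [ac bc]] [ar rb]]; split=> //; first by apply/andP.
  by rewrite addrA !lerD2r; apply/andP.
have gE x : (beta x + c - (alpha x + c) = beta x - alpha x)%R by ring.
have igc : PX.-integrable [set: TX] (fun x => (beta x + c - (alpha x + c))%:E).
  by under eq_fun do rewrite gE.
have maddc (d : measure_display) (T : measurableType d) (f : T -> R) :
    measurable_fun [set: T] f -> measurable_fun [set: T] (fun x => f x + c)%R.
  by move=> mf; exact: measurable_funD.
have [irln le_irln] := @integral_xlnx_le_normalized (fun x => alpha x + c)%R
  (fun x => beta x + c)%R (fun z => b z + c)%R
  (maddc _ _ _ mal) (maddc _ _ _ mbe) (maddc _ _ _ mb) envc igc.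
split=> //; apply: (le_trans le_irln); rewrite le_eqVlt; apply/orP; left; apply/eqP.
apply: ae_eq_integral => //.
- apply/measurable_EFinP/measurable_funM => //; apply: measurable_funM.
    by apply: measurable_funB; exact: measurable_funD.
  exact: measurableT_comp.
- apply/measurable_EFinP/measurable_funM => //; apply: measurable_funM.
    by apply: measurableT_comp => //; exact: measurable_funB.
  exact: measurableT_comp.
apply: filterS envc => xz [_ /andP[ac bc] _] _.
by rewrite gE [`|beta _ - _|%R]ger0_norm// -gE subr_ge0 (le_trans ac).
Qed.

(** * The weighted Pinsker inequality combined with AM-GM *)

Section weighted_pinsker.
Variables (g : TX -> R) (phi : TX * TZ -> R) (A B t : R).
Hypotheses (mg : measurable_fun [set: TX] g)
  (mphi : measurable_fun [set: TX * TZ] phi) (phi0 : forall xz, (0 <= phi xz)%R)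
  (A0 : (0 <= A)%R) (B0 : (0 <= B)%R) (AB : (A + B = 2)%R) (t0 : (0 < t)%R)
  (w_phi : {ae pi, forall xz, (w xz ^+ 2 <= (A + B * r xz) * phi xz)%R}).

(** The right-hand side is half of [m], and [m] dominates [|G * v|] because
    [m ^+ 2 - G ^+ 2 * W * p] is a square. *)
Let am_gm (G v W p : R) : (0 <= W)%R -> (0 <= p)%R -> (v ^+ 2 <= W * p)%R ->
  (2^-1 * (`|G| * `|v|) <= t / 4 * (G ^+ 2 * W) + (4 * t)^-1 * p)%R.
Proof.
move=> W0 p0 vWp; pose m := (t / 2 * (G ^+ 2 * W) + (2 * t)^-1 * p)%R.
have m0 : (0 <= m)%R.
  have t2 : (0 <= t / 2)%R by rewrite divr_ge0 ?ltW.
  have t2' : (0 <= (2 * t)^-1)%R by rewrite invr_ge0 mulr_ge0 ?ltW.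
  by apply: addr_ge0; apply: mulr_ge0 => //; rewrite mulr_ge0 ?sqr_ge0.
have : (`|G * v| <= m)%R.
  rewrite -(ger0_norm m0) -ler_sqr ?nnegrE// !real_normK ?num_real// exprMn.
  apply: le_trans (ler_wpM2l (sqr_ge0 G) vWp) _; rewrite -subr_ge0.
  rewrite [leRHS](_ : _ = (t / 2 * (G ^+ 2 * W) - (2 * t)^-1 * p) ^+ 2)%R ?sqr_ge0//.
  by rewrite /m; field; exact: lt0r_neq0.
rewrite normrM /m => h; rewrite [leRHS](_ : _ = 2^-1 * m)%R; last first.
  by rewrite /m; field; exact: lt0r_neq0.
by rewrite ler_pM2l.
Qed.

(** Integrated over [z], the weight [A + B * r] gives [A + B = 2] for almost every [x], so only the
    second moment of [g] remains of the first term of [am_gm]. *)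
Lemma weighted_pinsker :
  \int[pi]_xz (2^-1 * (`|g xz.1| * `|w xz|))%:E <=
  (t / 2)%:E * \int[PX]_x (g x ^+ 2)%:E + ((4 * t)^-1)%:E * \int[pi]_xz (phi xz)%:E.
Proof.
have t4 : (0 <= (4 * t)^-1)%R by rewrite invr_ge0 mulr_ge0 ?ltW.
have mg2 : measurable_fun [set: TX] (fun x => (t / 4 * g x ^+ 2)%R).
  by apply: measurable_funM => //; exact: measurable_funX.
have g20 x : (0 <= t / 4 * g x ^+ 2)%R.
  by rewrite mulr_ge0 ?sqr_ge0 ?divr_ge0 ?(ltW t0).
have mW : measurable_fun [set: TX * TZ] (fun xz => (A + B * r xz)%R).
  by apply: measurable_funD => //; exact: measurable_funM.
have W0 xz : (0 <= A + B * r xz)%R by rewrite addr_ge0// mulr_ge0.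
have -> : (t / 2)%:E * \int[PX]_x (g x ^+ 2)%:E =
    \int[pi]_xz (t / 4 * g xz.1 ^+ 2 * (A + B * r xz))%:E.
  rewrite (@ge0_integral_product_weight _ _ _ _ _ PX Q
    (fun x => t / 4 * g x ^+ 2)%R (fun xz => A + B * r xz)%R (A + B))//; last first.
    exact: marginal1_affine.
  have mEg2 : measurable_fun [set: TX] (fun x => (g x ^+ 2)%:E).
    by apply/measurable_EFinP; exact: measurable_funX.
  have Eg20 x : [set: TX] x -> 0 <= (g x ^+ 2)%:E by rewrite lee_fin sqr_ge0.
  have Et0 : 0 <= (t / 2)%:E by rewrite lee_fin divr_ge0 ?(ltW t0).
  rewrite -(ge0_integralZl _ measurableT mEg2 Eg20 Et0)//.
  by apply: eq_integral => x _; rewrite AB -EFinM; congr (_%:E); field.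
have mEphi : measurable_fun [set: TX * TZ] (fun xz => (phi xz)%:E).
  exact/measurable_EFinP.
have Ephi0 xz : [set: TX * TZ] xz -> 0 <= (phi xz)%:E by rewrite lee_fin.
have Et40 : 0 <= ((4 * t)^-1)%:E by rewrite lee_fin.
rewrite -(ge0_integralZl _ measurableT mEphi Ephi0 Et40)//.
have mg2W : measurable_fun [set: TX * TZ]
    (fun xz => (t / 4 * g xz.1 ^+ 2 * (A + B * r xz))%:E).
  by apply/measurable_EFinP/measurable_funM => //; exact: measurableT_comp mg2 measurable_fst.
have mtphi : measurable_fun [set: TX * TZ] (fun xz => ((4 * t)^-1)%:E * (phi xz)%:E).
  by apply: measurable_funeM; exact/measurable_EFinP.
have Eg2W0 xz : [set: TX * TZ] xz -> 0 <= (t / 4 * g xz.1 ^+ 2 * (A + B * r xz))%:E.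
  by rewrite lee_fin mulr_ge0.
have Etphi0 xz : [set: TX * TZ] xz -> 0 <= ((4 * t)^-1)%:E * (phi xz)%:E.
  by move=> _; rewrite mule_ge0 ?lee_fin.
rewrite -(ge0_integralD _ measurableT Eg2W0 mg2W Etphi0 mtphi).
apply: ae_ge0_le_integral => //.
- apply/measurable_EFinP/measurable_funM => //; apply: measurable_funM.
    apply: measurableT_comp => //; exact: measurableT_comp.
  exact: measurableT_comp.
- by move=> xz _; apply: adde_ge0; [exact: Eg2W0|exact: Etphi0].
- exact: emeasurable_funD.
apply: filterS w_phi => xz hxz _; rewrite -EFinM -EFinD lee_fin -mulrA.
exact: am_gm.
Qed.

End weighted_pinsker.

(** * The integral of [- ln r] and the case of density 1 *)

Let neg_ln xz := (- ln (r xz))%R.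
(** The absolute value only matters where [r = 0]: there [ln 0 = 0] would make the expression equal
    to -1. *)
Let phi2 xz := `|r xz - 1 - ln (r xz)|%R.

Let mneg_ln : measurable_fun [set: TX * TZ] neg_ln.
Proof.
by apply: measurableT_comp => //; exact: measurableT_comp (@measurable_ln R) mr.
Qed.

Let mphi2 : measurable_fun [set: TX * TZ] phi2.
Proof.
by apply: measurableT_comp => //; apply: measurable_funD.
Qed.

(** The negative part of [- ln r] is at most [r], hence integrable; so an integral below [+oo] makes
    [- ln r] integrable, and adding r - 1 does not change its integral. *)
Let integral_phi2 : {ae pi, forall xz, 0 < r xz}%R ->
  \int[pi]_xz (neg_ln xz)%:E < +oo ->
  \int[pi]_xz (phi2 xz)%:E = \int[pi]_xz (neg_ln xz)%:E.
Proof.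
move=> r_gt0 Loo.
have mEn : measurable_fun [set: TX * TZ] (EFin \o neg_ln) by exact/measurable_EFinP.
have ineg : \int[pi]_xz (EFin \o neg_ln)^\- xz < +oo.
  apply: le_lt_trans (integrable_lty measurableT density_integrable_product) => //.
  apply: ae_ge0_le_integral => //.
  - exact: measurable_funeneg.
  - by move=> xz _; rewrite lee_fin.
  - exact/measurable_EFinP.
  apply: filterS r_gt0 => xz rxz _; rewrite funenegE /= ge_max !lee_fin r0 andbT.
  by rewrite /neg_ln opprK; have := ln_le_subr1 rxz; lra.
have ipos : \int[pi]_xz (EFin \o neg_ln)^\+ xz < +oo.
  move: Loo; rewrite integralE; apply: contraTT; rewrite -!leNgt !leye_eq => /eqP ->.
  by rewrite addye// eqe_oppLR; apply: contraTneq ineg => ->.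
have iln : pi.-integrable [set: TX * TZ] (EFin \o neg_ln).
  apply/integrableP; split => //.
  rewrite (eq_integral ((EFin \o neg_ln)^\+ \+ (EFin \o neg_ln)^\-)); last first.
    by move=> xz _; exact: (congr1 (@^~ xz) (fune_abse (EFin \o neg_ln))).
  rewrite ge0_integralD//.
  - by rewrite lte_add_pinfty.
  - exact: measurable_funepos.
  - exact: measurable_funeneg.
rewrite -[RHS]add0e -integral_density_subr1 -integralD//.
apply: ae_eq_integral => //.
- exact/measurable_EFinP.
- apply: emeasurable_funD => //; exact/measurable_EFinP.
apply: filterS r_gt0 => xz rxz _; rewrite -EFinD /phi2 ger0_norm//.
by rewrite subr_ge0 ln_le_subr1.
Qed.

Lemma integral_neg_ln_ge0 : {ae pi, forall xz, 0 < r xz}%R ->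
  \int[pi]_xz (neg_ln xz)%:E < +oo -> 0 <= \int[pi]_xz (- ln (r xz))%:E.
Proof.
move=> r_gt0 Loo; rewrite -(integral_phi2 r_gt0 Loo).
by apply: integral_ge0 => xz _; rewrite lee_fin /phi2.
Qed.

(** Serves the degenerate cases in which a bound reads [0 * +oo], that is 0, and the mutual
    information has to be shown to vanish. *)
Lemma xlnx_eq0_of_density1 : {ae pi, forall xz, r xz = 1%R} ->
  \int[pi]_xz (r xz * ln (r xz))%:E = 0.
Proof.
move=> r1; rewrite (@ae_eq_integral _ _ _ pi _ (cst 0)) ?integral0//.
  apply/measurable_EFinP/measurable_funM => //.
  exact: measurableT_comp (@measurable_ln R) mr.
by apply: filterS r1 => xz -> _; rewrite ln1 mulr0.
Qed.

Lemma density1_of_integral_subr1 : \int[pi]_xz (`|r xz - 1|)%:E = 0 ->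
  {ae pi, forall xz, r xz = 1%R}.
Proof.
move=> w0; have /ae_eq_integral_abs : measurable_fun [set: TX * TZ] (EFin \o w).
  exact/measurable_EFinP.
move=> /(_ pi measurableT)[/(_ w0) + _]; apply: filterS => xz /(_ I)[].
by move/eqP; rewrite subr_eq0 => /eqP.
Qed.

(** The integral of [phi2] is then 0, so [phi2] vanishes almost everywhere, and [sqr_subr1_le_subln]
    bounds (r - 1)^2 by a multiple of it. *)
Lemma density1_of_integral_neg_ln : {ae pi, forall xz, 0 < r xz}%R ->
  \int[pi]_xz (- ln (r xz))%:E = 0 -> {ae pi, forall xz, r xz = 1%R}.
Proof.
move=> r_gt0 L0; have := integral_phi2 r_gt0; rewrite L0 ltry => /(_ isT) phi0.
have /ae_eq_integral_abs : measurable_fun [set: TX * TZ] (EFin \o phi2).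
  exact/measurable_EFinP.
move=> /(_ pi measurableT)[+ _].
under eq_integral do rewrite /= /phi2 normr_id.
move=> /(_ phi0); move: r_gt0; apply: filterS2 => xz rxz /(_ I)[] /normr0_eq0 lnr.
apply/eqP; rewrite -subr_eq0 -sqrf_eq0 eq_le sqr_ge0 andbT.
by rewrite (le_trans (sqr_subr1_le_subln rxz))// lnr mulr0.
Qed.

Let le_sqrt_of_optimal (i k l : R) : (0 <= k)%R -> (0 <= l)%R ->
  (forall t, 0 < t -> i <= t / 2 * k + (4 * t)^-1 * l)%R ->
  (i <= Num.sqrt (2^-1 * k * l))%R.
Proof.
move=> k0 l0 opt; have [i0|i0] := leP i 0%R; first exact: le_trans i0 (sqrtr_ge0 _).
rewrite -(@ler_sqr _ i) ?nnegrE ?sqrtr_ge0 ?(ltW i0)// sqr_sqrtr ?mulr_ge0//.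
have [k_gt0|] := ltP 0%R k; last first.
  move=> k_le0; have {}k0 : k = 0%R by apply/eqP; rewrite eq_le k_le0.
  (* For [k = 0] this [t] turns the hypothesis into i <= i l / (l + 1), which contradicts i > 0. *)
  have t0 : (0 < (l + 1) / (4 * i))%R by rewrite divr_gt0 ?mulr_gt0//; lra.
  have := opt _ t0; rewrite k0 mulr0 add0r.
  rewrite [X in (_ <= X)%R -> _](_ : _ = i * l / (l + 1))%R; last by field; lra.
  by rewrite ler_pdivlMr; nra.
(* The choice t = i / k agrees with the minimizer sqrt(l / (2k)) in the case of equality and stays
   positive when l = 0. *)
have := opt _ (divr_gt0 i0 k_gt0).
rewrite [X in (_ <= X)%R -> _](_ : _ = (2 * i ^+ 2 + k * l) / (4 * i))%R; last first.
  by field; lra.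
by rewrite ler_pdivlMr; nra.
Qed.

(** * The three bounds in terms of the density ratio *)

Section bounds.
Variables (alpha beta : TX -> R) (b : TZ -> R).
Hypotheses (mal : measurable_fun [set: TX] alpha)
  (mbe : measurable_fun [set: TX] beta) (mb : measurable_fun [set: TZ] b)
  (env : {ae PX, forall x, {ae Q, forall z, (0 < r (x, z))%R /\
     (alpha x <= ln (r (x, z)) + b z <= beta x)%R}}).

Let g x := (beta x - alpha x)%R.
Let mg : measurable_fun [set: TX] g. Proof. exact: measurable_funB. Qed.

Lemma integral_xlnx_le_bounded (S : R) : (0 <= S)%R ->
  {ae PX, forall x, `|beta x - alpha x| <= S}%R ->
  \int[pi]_xz (r xz * ln (r xz))%:E <=
  S%:E * (2^-1%:E * \int[pi]_xz (`|r xz - 1|)%:E).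
Proof.
move=> S0 gS; have ig : PX.-integrable [set: TX] (EFin \o g).
  apply: ae_le_integrable (finite_measure_integrable_cst PX S measurableT).
    exact/measurable_EFinP.
  by apply: filterS gS => x gx; rewrite /= lee_fin (ger0_norm S0).
have [_ /le_trans] := integral_xlnx_le mal mbe mb env ig; apply.
have mnw : measurable_fun [set: TX * TZ] (fun xz => (`|r xz - 1|)%:E).
  by apply/measurable_EFinP; apply: measurableT_comp.
have mnw2 : measurable_fun [set: TX * TZ] (fun xz => 2^-1%:E * (`|r xz - 1|)%:E).
  exact: measurable_funeM.
have nw0 xz : [set: TX * TZ] xz -> 0 <= (`|r xz - 1|)%:E by rewrite lee_fin.
have nw20 xz : [set: TX * TZ] xz -> 0 <= 2^-1%:E * (`|r xz - 1|)%:E.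
  by move=> _; rewrite mule_ge0 ?lee_fin ?invr_ge0.
have half0 : 0 <= (2^-1 : R)%:E by rewrite lee_fin invr_ge0.
have ES0 : 0 <= S%:E by rewrite lee_fin.
rewrite -(ge0_integralZl pi measurableT mnw nw0 half0).
rewrite -(ge0_integralZl pi measurableT mnw2 nw20 ES0).
apply: ae_ge0_le_integral => //.
- apply/measurable_EFinP/measurable_funM => //.
  apply: measurable_funM; last exact: measurableT_comp.
  by apply: measurableT_comp => //; exact: measurableT_comp mg measurable_fst.
- by move=> xz xzT; rewrite mule_ge0 ?nw20.
- exact: measurable_funeM.
have gS2 : {ae pi, forall xz, `|beta xz.1 - alpha xz.1| <= S}%R.
  apply: (@ae_product _ _ _ _ _ PX Q [set xz | `|beta xz.1 - alpha xz.1| <= S]%R).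
    rewrite -[X in measurable X]setTI; apply: measurable_fun_le => //.
    by apply: measurableT_comp => //; exact: measurableT_comp mg measurable_fst.
  by apply: filterS gS => x gx; apply: aeW.
apply: filterS gS2 => xz gxz _; rewrite -!EFinM lee_fin mulrCA.
by rewrite ler_wpM2r ?mulr_ge0.
Qed.

Let G2 := \int[PX]_x (g x ^+ 2)%:E.
Hypothesis G2oo : G2 < +oo.

Let ig : PX.-integrable [set: TX] (EFin \o g).
Proof.
have i1g2 : PX.-integrable [set: TX] (fun x => (1 + g x ^+ 2)%:E).
  apply: (@integrableD _ _ _ PX _ measurableT (EFin \o cst 1%R) (fun x => (g x ^+ 2)%:E)).
    exact: (finite_measure_integrable_cst PX 1 measurableT).
  apply/integrableP; split; first by apply/measurable_EFinP; exact: measurable_funX.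
  by under eq_integral do rewrite /= ger0_norm ?sqr_ge0//.
apply: (le_integrable measurableT _ _ i1g2); first exact/measurable_EFinP.
move=> x _; rewrite /= lee_fin [leRHS]ger0_norm ?addr_ge0 ?sqr_ge0//.
by rewrite ler_norml; nra.
Qed.

Let G2_fin : G2 \is a fin_num.
Proof. by rewrite ge0_fin_numE// integral_ge0// => x _; rewrite lee_fin sqr_ge0. Qed.

Let I_fin : \int[pi]_xz (r xz * ln (r xz))%:E \is a fin_num.
Proof.
by have [irln _] := integral_xlnx_le mal mbe mb env ig; exact: integrable_fin_num.
Qed.

Lemma integral_xlnx_le_half_sqr :
  \int[pi]_xz (r xz * ln (r xz))%:E <= 2^-1%:E * G2.
Proof.
have [irln le_irln] := integral_xlnx_le mal mbe mb env ig.
pose phi1 xz := (r xz * ln (r xz) - r xz + 1)%R.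
have phi1_ge0 xz : (0 <= phi1 xz)%R by rewrite /phi1; have := xlnx_ge (r0 xz); lra.
have mphi1 : measurable_fun [set: TX * TZ] phi1.
  apply: measurable_funD => //; apply: measurable_funB => //.
  by apply: measurable_funM => //; exact: measurableT_comp (@measurable_ln R) mr.
have int_phi1 : \int[pi]_xz (phi1 xz)%:E = \int[pi]_xz (r xz * ln (r xz))%:E.
  rewrite -[RHS]sube0 -integral_density_subr1 -integralB//.
  by apply: eq_integral => xz _; rewrite -EFinB /phi1 /w; congr (_%:E); ring.
have wp : \int[pi]_xz (2^-1 * (`|beta xz.1 - alpha xz.1| * `|w xz|))%:E
    <= (2^-1 / 2)%:E * G2 + ((4 * 2^-1)^-1)%:E * \int[pi]_xz (phi1 xz)%:E.
  have [h1 h2 h3 h4] : [/\ 0 <= 4/3 :> R, 0 <= 2/3 :> R, 4/3 + 2/3 = 2 :> R &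
    0 < 2^-1 :> R]%R by split; lra.
  apply: (@weighted_pinsker g phi1 _ _ _ mg mphi1 phi1_ge0 h1 h2 h3 h4).
  by apply: aeW => xz; exact: sqr_subr1_le_xlnx.
(* With t = 1/2 this reads I <= G2/4 + I/2; since I is finite, I/2 can be absorbed into the
   left-hand side. *)
move: wp; rewrite int_phi1 => /(le_trans le_irln).
rewrite -(fineK I_fin) -(fineK G2_fin) -!EFinM -EFinD !lee_fin.
by set i := fine _; set k := fine _; lra.
Qed.

Lemma integral_xlnx_le_sqrt : {ae pi, forall xz, 0 < r xz}%R ->
  \int[pi]_xz (- ln (r xz))%:E < +oo ->
  \int[pi]_xz (r xz * ln (r xz))%:E <=
  (2^-1%:E * G2 * \int[pi]_xz (- ln (r xz))%:E) `^ 2^-1.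
Proof.
move=> r_gt0 Loo.
have [irln le_irln] := integral_xlnx_le mal mbe mb env ig.
have phi2L := integral_phi2 r_gt0 Loo.
have L0 := integral_neg_ln_ge0 r_gt0 Loo.
have L_fin : \int[pi]_xz (- ln (r xz))%:E \is a fin_num by rewrite ge0_fin_numE.
have wp t : (0 < t)%R -> \int[pi]_xz (r xz * ln (r xz))%:E <=
    (t / 2)%:E * G2 + ((4 * t)^-1)%:E * \int[pi]_xz (- ln (r xz))%:E.
  move=> t0; apply: (le_trans le_irln); rewrite -phi2L.
  have [h1 h2 h3] : [/\ 0 <= 2/3 :> R, 0 <= 4/3 :> R & 2/3 + 4/3 = 2 :> R]%R.
    by split; lra.
  have phi2_ge0 xz : (0 <= phi2 xz)%R by rewrite /phi2.
  apply: (@weighted_pinsker g phi2 _ _ _ mg mphi2 phi2_ge0 h1 h2 h3 t0).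
  apply: filterS r_gt0 => xz rxz; apply: le_trans (sqr_subr1_le_subln rxz) _.
  apply: ler_wpM2l; last exact: ler_norm.
  by apply: addr_ge0 => //; apply: mulr_ge0 => //; exact: ltW.
have G20 : 0 <= G2 by apply: integral_ge0 => x _; rewrite lee_fin sqr_ge0.
move: wp L0 G20; rewrite -(fineK I_fin) -(fineK G2_fin) -(fineK L_fin).
set i := fine _; set k := fine _; set l := fine _ => wp.
rewrite !lee_fin => l0 k0; rewrite powR12_sqrt ?mulr_ge0//.
exact: le_sqrt_of_optimal.
Qed.

End bounds.

End log_oscillation.

(** * Densities on product spaces *)

(** Measurability is not assumed: the integral of a nonnegative function is the supremum over the
    simple functions below it. This is applied to [gamma] and to [d_TV]. *)
Lemma ge0_le_integral_any {d : measure_display} {T : measurableType d}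
    {R : realType} (mu : {measure set T -> \bar R}) (D : set T) (f g : T -> \bar R) :
  (forall x, D x -> 0 <= f x) -> (forall x, D x -> f x <= g x) ->
  \int[mu]_(x in D) f x <= \int[mu]_(x in D) g x.
Proof.
move=> f0 fg; have g0 x : D x -> 0 <= g x.
  by move=> Dx; exact: le_trans (f0 _ Dx) (fg _ Dx).
rewrite !ge0_integralE//; apply: le_ereal_sup => _ /= [h hf <-]; exists h => // x.
apply: le_trans (hf x) _; rewrite !patchE; case: ifPn => // /set_mem; exact: fg.
Qed.

Lemma sigma_finite_restriction {d : measure_display} {T : measurableType d}
    {R : realType} (nu : {measure set T -> \bar R}) (D : set T) :
  measurable D -> sigma_finite D nu ->
  exists mu : {sigma_finite_measure set T -> \bar R},
    forall A, mu A = nu (A `&` D).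
Proof.
move=> mD [F DF mF].
have sfin : sigma_finite [set: T] (mrestr nu mD).
  (* The complement of [D], null for the restricted measure, is put in front of the cover of [D]. *)
  exists (fun n => if n is m.+1 then F m else ~` D).
    rewrite -(setvU D) setUC DF; apply/seteqP; split=> x.
      by case=> [[n _ Fnx]|?]; [exists n.+1|exists 0%N].
    by case=> -[|n] _ ?; [right|left; exists n].
  case=> [|n]; first by split; [exact: measurableC|rewrite /mrestr setICl measure0].
  have [mFn Fnoo] := mF n; split=> //; apply: le_lt_trans Fnoo.
  by apply: le_measure; rewrite ?inE//; exact: measurableI.
pose H := Measure_isSigmaFinite.Build _ _ _ (mrestr nu mD) sfin.
pose mu : {sigma_finite_measure set T -> \bar R} := HB.pack (mrestr nu mD) H.
by exists mu.
Qed.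

(** Both sides are measures in [C], the left one finite, that agree on measurable rectangles; these
    are stable under intersection and generate the product sigma-algebra. *)
Lemma integral_density_product {d1 d2 : measure_display}
    {T1 : measurableType d1} {T2 : measurableType d2} {R : realType}
    (m1 : probability T1 R) (m2 : probability T2 R)
    (m : probability (T1 * T2)%type R) (r : T1 * T2 -> R) :
  measurable_fun [set: T1 * T2] r -> (forall xz, 0 <= r xz)%R ->
  (forall A B, measurable A -> measurable B ->
    m (A `*` B) = \int[m1]_(x in A) \int[m2]_(z in B) (r (x, z))%:E) ->
  forall C, measurable C -> m C = \int[m1 \x m2]_(xz in C) (r xz)%:E.
Proof.
move=> mr r0 mE.
pose m' C := \int[m1 \x m2]_(xz in C) (r xz)%:E.
have mEr : measurable_fun [set: T1 * T2] (EFin \o r) by exact/measurable_EFinP.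
have Er0 xz : 0 <= (EFin \o r) xz by rewrite lee_fin.
have m'0 : m' set0 = 0 by rewrite /m' integral_set0.
have m'_ge0 A : 0 <= m' A by apply: integral_ge0 => xz _; rewrite lee_fin.
have m'_add : semi_sigma_additive m'.
  exact: (semi_sigma_additive_nng_induced mEr Er0).
pose H := isMeasure.Build _ _ _ m' m'0 m'_ge0 m'_add.
pose mm : {measure set (T1 * T2) -> \bar R} := HB.pack m' H.
move=> C mC; rewrite -[RHS]/(mm C).
apply: (measure_unique [set A `*` B | A in measurable & B in measurable]
  (fun=> setT)) => //.
- by rewrite measurable_prod_measurableType.
- move=> _ _ [A1 mA1 [B1 mB1 <-]] [A2 mA2 [B2 mB2 <-]].
  exists (A1 `&` A2); first exact: measurableI.
  by exists (B1 `&` B2); [exact: measurableI|rewrite setXI].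
- by exists setT => //; exists setT => //; rewrite setXTT.
- by apply/seteqP; split => // x _; exists 0%N.
- move=> _ [A mA [B mB <-]]; apply: (etrans (mE _ _ mA mB)).
  rewrite -[RHS]/(m' (A `*` B)) /m'.
  rewrite [RHS]integral_mkcond fubini_tonelli1//; last 2 first.
  - apply: (measurable_restrictT _ (measurableX mA mB)).1.
    exact: measurable_funTS mEr.
  - by move=> xz; rewrite patchE; case: ifPn => // _; exact: Er0.
  rewrite [LHS]integral_mkcond; apply: eq_integral => x _; rewrite /fubini_F.
  rewrite patchE; case: ifPn => xA.
    rewrite [LHS]integral_mkcond; apply: eq_integral => z _.
    by rewrite !patchE in_setX/= xA.
  by rewrite integral0_eq// => z _; rewrite patchE in_setX/= (negbTE xA).
- by move=> _; rewrite (le_lt_trans (probability_le1 _ _))// ltry.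
Qed.

(** * Mixtures of densities *)

Lemma measurable_invr (R : realType) (d : measure_display) (T : measurableType d)
    (f : T -> R) : (forall x, 0 <= f x)%R -> measurable_fun [set: T] f ->
  measurable_fun [set: T] (fun x => (f x)^-1)%R.
Proof.
move=> f0 mf; rewrite (_ : (fun _ => _) = (fun x => f x `^ (-1))%R).
  exact: measurableT_comp (@measurable_powR R (-1)) mf.
by apply/funext => x; rewrite powR_inv1.
Qed.

Section mixture.
Context {dX dZ : measure_display} {TX : measurableType dX}
  {TZ : measurableType dZ} {R : realType}.
Variables (PX : probability TX R) (Q : probability TZ R)
  (mu : {sigma_finite_measure set TZ -> \bar R}) (p : TX * TZ -> R).
Hypotheses (mp : measurable_fun [set: TX * TZ] p) (p0 : forall xz, (0 <= p xz)%R)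
  (QE : forall B, measurable B -> Q B = \int[PX]_x \int[mu]_(z in B) (p (x, z))%:E).

Let q z := \int[PX]_x (p (x, z))%:E.

(** [q] is finite only [mu]-almost everywhere; [fine] sends the value [+oo] to 0. Where the mixture
    density is 0, so is the ratio, division by 0 being 0. *)
Definition mixture_density z : R := fine (q z).
Definition density_ratio xz : R := (p xz / mixture_density xz.2)%R.
Local Notation qr := mixture_density.
Local Notation r := density_ratio.

Let mEp : measurable_fun [set: TX * TZ] (EFin \o p).
Proof. exact/measurable_EFinP. Qed.

Let Ep0 xz : 0 <= (EFin \o p) xz. Proof. by rewrite lee_fin. Qed.

Let mpx x : measurable_fun [set: TZ] (fun z => (p (x, z))%:E).
Proof. exact: measurableT_comp mEp (pair1_measurable x). Qed.

Let mq : measurable_fun [set: TZ] q.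
Proof. exact: (measurable_fun_fubini_tonelli_G (m1 := PX) (EFin \o p) mEp Ep0). Qed.

Let q0 z : 0 <= q z.
Proof. by apply: integral_ge0 => x _; rewrite lee_fin. Qed.

Lemma measurable_mixture_density : measurable_fun [set: TZ] qr.
Proof. by apply: measurableT_comp => //; exact: fine_measurable. Qed.
Let mqr := measurable_mixture_density.

Lemma mixture_density_ge0 z : (0 <= qr z)%R.
Proof. exact: fine_ge0. Qed.
Let qr0 := mixture_density_ge0.

Lemma measurable_density_ratio : measurable_fun [set: TX * TZ] r.
Proof.
apply: measurable_funM => //; apply: measurable_invr => //.
exact: measurableT_comp mqr measurable_snd.
Qed.
Let mr := measurable_density_ratio.

Lemma density_ratio_ge0 xz : (0 <= r xz)%R.
Proof. by rewrite mulr_ge0 ?invr_ge0. Qed.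
Let r0 := density_ratio_ge0.

Let patch_p (B : set TZ) (x : TX) (z : TZ) :
  ((fun z => (p (x, z))%:E) \_ B) z = ((EFin \o p) \_ ([set: TX] `*` B)) (x, z).
Proof. by rewrite !patchE in_setX/= in_setT. Qed.

Let QEq B : measurable B -> Q B = \int[mu]_(z in B) q z.
Proof.
move=> mB; rewrite QE//.
under eq_integral do rewrite integral_mkcond.
under eq_integral => x _ do under eq_integral => z _ do rewrite patch_p.
rewrite fubini_tonelli; last 2 first.
- apply: (measurable_restrictT _ _).1; first exact: measurableX.
  exact: measurable_funTS mEp.
- by move=> xz; rewrite patchE; case: ifPn.
rewrite [RHS]integral_mkcond; apply: eq_integral => z _; rewrite patchE.
case: ifPn => zB.
  by apply: eq_integral => x _; rewrite -patch_p patchE zB.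
by rewrite integral0_eq// => x _; rewrite -patch_p patchE (negbTE zB).
Qed.

Let q_fin : {ae mu, forall z, q z \is a fin_num}.
Proof.
have iq : mu.-integrable [set: TZ] q.
  apply/integrableP; split=> //.
  under eq_integral do rewrite gee0_abs//.
  by rewrite -QEq// (le_lt_trans (probability_le1 _ _))// ltry.
by apply: filterS (integrable_ae measurableT iq) => z; exact.
Qed.

Lemma mixture_densityE B : measurable B -> Q B = \int[mu]_(z in B) (qr z)%:E.
Proof.
move=> mB; rewrite QEq//; apply: ae_eq_integral => //.
- exact: measurable_funTS.
- by apply/measurable_EFinP; exact: measurable_funTS.
by apply: filterS q_fin => z qz _; rewrite /qr fineK.
Qed.

Let mN : measurable [set z | qr z = 0%R].
Proof.
rewrite (_ : [set z | _] = qr @^-1` [set 0%R])//.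
by rewrite -[X in measurable X]setTI; exact: mqr.
Qed.

Let QN0 : Q [set z | qr z = 0%R] = 0.
Proof.
by rewrite mixture_densityE// integral0_eq// => z ->.
Qed.

Lemma mixture_density_gt0 : {ae Q, forall z, (0 < qr z)%R}.
Proof.
exists [set z | qr z = 0%R]; split => // z /= /negP.
by rewrite -leNgt => qz; apply/eqP; rewrite eq_le qz qr0.
Qed.

(** Off the zero set of the mixture density, p is the ratio times that density. The zero set is
    [Q]-null, so for almost every [x] the density p_x vanishes [mu]-almost everywhere on it; this
    choice of [x] is independent of [B]. *)
Lemma density_ratioE : {ae PX, forall x, forall B, measurable B ->
  \int[mu]_(z in B) (p (x, z))%:E = \int[Q]_(z in B) (r (x, z))%:E}.
Proof.
have pN : {ae PX, forall x, \int[mu]_(z in [set z | qr z = 0%R]) (p (x, z))%:E = 0}.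
  pose F x := \int[mu]_(z in [set z | qr z = 0%R]) (p (x, z))%:E.
  have F0 x : 0 <= F x by apply: integral_ge0 => z _; rewrite lee_fin.
  have mF : measurable_fun [set: TX] F.
    exact: measurable_integral_section.
  have /(ae_eq_integral_abs PX measurableT mF) : \int[PX]_x `|F x| = 0.
    by under eq_integral do rewrite gee0_abs//; rewrite -QE.
  by apply: filterS => x; exact.
apply: filterS pN => x px0 B mB.
have mrx : measurable_fun [set: TZ] (fun z => (r (x, z))%:E).
  by apply/measurable_EFinP; exact: measurableT_comp mr (pair1_measurable x).
have mrB : measurable_fun [set: TZ] ((fun z => (r (x, z))%:E) \_ B).
  by apply: (measurable_restrictT _ _).1 => //; exact: measurable_funTS mrx.
rewrite [LHS]integral_mkcond [RHS]integral_mkcond.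
rewrite (ge0_integral_density mqr qr0 mixture_densityE mrB); last first.
  by move=> z; rewrite patchE; case: ifPn => // _; rewrite lee_fin.
apply: ae_eq_integral => //.
- by apply: (measurable_restrictT _ _).1 => //; exact: measurable_funTS (mpx x).
- by apply: emeasurable_funM => //; exact/measurable_EFinP.
have /(ae_eq_integral_abs mu mN (measurable_funTS (mpx x))) :
    \int[mu]_(z in [set z | qr z = 0%R]) `|(p (x, z))%:E| = 0.
  by under eq_integral do rewrite gee0_abs ?lee_fin//.
apply: filterS => z pz _; rewrite !patchE; case: ifPn => _; last by rewrite mul0e.
rewrite -EFinM /r/=; have [qz|qz] := eqVneq (qr z) 0%R; last by rewrite mulfVK.
by rewrite qz mulr0; exact: pz.
Qed.

Lemma density_ratio_marginal2 : {ae Q, forall z, \int[PX]_x (r (x, z))%:E = 1}.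
Proof.
apply: filterS mixture_density_gt0 => z qz.
under eq_integral => x _ do rewrite /r EFinM/=.
rewrite ge0_integralZr//=; last 3 first.
- exact: measurableT_comp mEp (pair2_measurable z).
- by move=> x _; rewrite lee_fin.
- by rewrite lee_fin invr_ge0.
have qfin : q z \is a fin_num.
  by move: qz; rewrite /qr; case: (q z) => //=; rewrite ltxx.
by rewrite -[X in X * _]/(q z) -(fineK qfin) -EFinM mulfV// lt0r_neq0.
Qed.

End mixture.

(** * Essential bounds *)

Section essential_bounds.
Context {dX dZ : measure_display} {TX : measurableType dX}
  {TZ : measurableType dZ} {R : realType}.
Variables (Q : probability TZ R).
Implicit Types p : TX * TZ -> R.

(** The essential supremum exceeds [y] exactly when the section of the set where p > y has positive
    [Q]-measure, and the measure of a section is measurable in [x]. *)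
Lemma measurable_ess_sup p : measurable_fun [set: TX * TZ] p ->
  measurable_fun [set: TX] (fun x => ess_sup Q (fun z => (p (x, z))%:E)).
Proof.
move=> mp mT; apply: (measurability _ (ErealGenOInfty.measurableE R)) => //.
move=> _ [_ [y ->] <-]; rewrite setTI.
have mA : measurable [set xz : TX * TZ | (y < p xz)%R].
  rewrite (_ : [set _ | _] = p @^-1` `]y, +oo[%classic).
    by rewrite -[X in measurable X]setTI; apply: mp => //; exact: measurable_itv.
  by apply/seteqP; split=> xz /=; rewrite in_itv/= andbT.
pose phi := Q \o xsection [set xz : TX * TZ | (y < p xz)%R].
have mphi : measurable_fun [set: TX] phi by exact: measurable_fun_xsection.
rewrite [X in measurable X](_ : _ = phi @^-1` `]0, +oo[%classic).
  by rewrite -[X in measurable X]setTI; apply: mphi => //; exact: emeasurable_itv.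
have mpx x : measurable_fun [set: TZ] (fun z => (p (x, z))%:E).
  by apply/measurable_EFinP; exact: measurableT_comp mp (pair1_measurable x).
have phiE x : (phi x = 0) <-> (ess_sup Q (fun z => (p (x, z))%:E) <= y%:E).
  have -> : phi x = Q ((fun z => (p (x, z))%:E) @^-1` `]y%:E, +oo[).
    rewrite /phi/=; congr (Q _); apply/seteqP; split=> z /=;
      by rewrite /xsection/= inE/= in_itv/= andbT lte_fin.
  split=> [/(ae_le_measureP Q _ (mpx x)).2 h|/ess_supP h]; first exact/ess_supP.
  exact: (ae_le_measureP Q _ (mpx x)).1.
apply/seteqP; split=> x /=; rewrite !in_itv/= !andbT.
  move=> yM; rewrite lt_neqAle measure_ge0 andbT eq_sym.
  by apply/eqP => /phiE; rewrite leNgt yM.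
by move=> phi_gt0; rewrite ltNge; apply/negP => /phiE phi0; rewrite phi0 ltxx in phi_gt0.
Qed.

Lemma measurable_ess_inf p : measurable_fun [set: TX * TZ] p ->
  measurable_fun [set: TX] (fun x => ess_inf Q (fun z => (p (x, z))%:E)).
Proof.
move=> mp; rewrite (_ : (fun _ => _) =
    fun x => - ess_sup Q (fun z => (- p (x, z))%:E)); last first.
  by apply/funext => x; rewrite ess_infEN.
apply: measurableT_comp => //.
by apply: (@measurable_ess_sup (fun xz => - p xz)%R); exact: measurableT_comp.
Qed.

Lemma ess_inf_le_ess_sup (f : TZ -> \bar R) : ess_inf Q f <= ess_sup Q f.
Proof.
apply: ess_sup_gee; last exact: ess_inf_le.
by rewrite [X in 0 < X]probability_setT.
Qed.

Variable p : TX * TZ -> R.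
Hypotheses (mp : measurable_fun [set: TX * TZ] p).

Let lo x := ess_inf Q (fun z => (p (x, z))%:E).
Let hi x := ess_sup Q (fun z => (p (x, z))%:E).

(** These two real-valued logarithms are meaningful only for a positive lower and a finite upper
    essential bound, which [ess_log_osc] tests. *)
Definition ln_ess_inf x : R := ln (fine (lo x)).
Definition ln_ess_sup x : R := ln (fine (hi x)).
Definition ess_log_osc x : \bar R :=
  if (0 < lo x) && (hi x < +oo) then (ln_ess_sup x - ln_ess_inf x)%:E else +oo.

Let mlo := measurable_ess_inf mp.
Let mhi := measurable_ess_sup mp.

Lemma measurable_ln_ess_inf : measurable_fun [set: TX] ln_ess_inf.
Proof.
apply: measurableT_comp (@measurable_ln R) _.
by apply: measurableT_comp mlo; exact: fine_measurable.
Qed.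

Lemma measurable_ln_ess_sup : measurable_fun [set: TX] ln_ess_sup.
Proof.
apply: measurableT_comp (@measurable_ln R) _.
by apply: measurableT_comp mhi; exact: fine_measurable.
Qed.

Lemma measurable_ess_log_osc : measurable_fun [set: TX] ess_log_osc.
Proof.
apply: measurable_fun_ifT => //.
- by apply: measurable_and; exact: measurable_fun_lte.
- apply/measurable_EFinP/measurable_funB.
    exact: measurable_ln_ess_sup.
  exact: measurable_ln_ess_inf.
Qed.

Let lo_hi x : lo x <= hi x. Proof. exact: ess_inf_le_ess_sup. Qed.

Let fin_lo_hi x : 0 < lo x -> hi x < +oo ->
  [/\ lo x = (fine (lo x))%:E, hi x = (fine (hi x))%:E,
      (0 < fine (lo x))%R & (fine (lo x) <= fine (hi x))%R].
Proof.
move=> lo0 hioo.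
have lo_fin : lo x \is a fin_num.
  by rewrite ge0_fin_numE ?(le_lt_trans (lo_hi x))// ltW.
have hi_fin : hi x \is a fin_num.
  by rewrite ge0_fin_numE// (le_trans _ (lo_hi x))// ltW.
split; rewrite ?fineK//; last by rewrite fine_le.
by rewrite fine_gt0// lo0 (le_lt_trans (lo_hi x)).
Qed.

Lemma ess_log_osc_ge0 x : 0 <= ess_log_osc x.
Proof.
rewrite /ess_log_osc; case: ifPn => [/andP[lo0 hioo]|_]; last exact: leey.
have [_ _ flo fle] := fin_lo_hi lo0 hioo.
by rewrite lee_fin subr_ge0 ler_ln ?posrE// (lt_le_trans flo).
Qed.

Lemma ess_log_osc_fin x : ess_log_osc x < +oo ->
  ess_log_osc x = (ln_ess_sup x - ln_ess_inf x)%:E /\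
  {ae Q, forall z, (0 < p (x, z))%R /\
    (ln_ess_inf x <= ln (p (x, z)) <= ln_ess_sup x)%R}.
Proof.
rewrite /ess_log_osc; case: ifPn => [/andP[lo0 hioo] _|_]; last by rewrite ltxx.
have [loE hiE flo fle] := fin_lo_hi lo0 hioo; split=> //.
have := @ess_sup_ge _ _ _ Q (fun z => (p (x, z))%:E).
have := @ess_inf_le _ _ _ Q (fun z => (p (x, z))%:E).
apply: filterS2 => z; rewrite -/(lo x) -/(hi x) loE hiE !lee_fin => lop phi.
have p_gt0 := lt_le_trans flo lop.
by rewrite !ler_ln ?posrE// ?lop// (lt_le_trans p_gt0).
Qed.

(** Essential bounds lie between the pointwise ones. The point where [f] is positive makes the
    supremum positive, so that a zero infimum yields [+oo] on the right. *)
Lemma ess_log_osc_le (SZ : set TZ) (f : TZ -> R) x :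
  (forall z, SZ z -> 0 <= f z)%R -> (exists2 z, SZ z & 0 < f z)%R ->
  {ae Q, forall z, SZ z} -> (forall z, SZ z -> p (x, z) = f z) ->
  ess_log_osc x <= lne (ereal_sup [set (f z)%:E | z in SZ] /
                        ereal_inf [set (f z)%:E | z in SZ]).
Proof.
move=> f0 [z0 SZz0 fz0] aeSZ pf.
set s := ereal_sup _; set i := ereal_inf _.
have sub z : SZ z -> (f z)%:E <= s.
  by move=> SZz; apply: ereal_sup_ubound; exists z.
have ilb z : SZ z -> i <= (f z)%:E.
  by move=> SZz; apply: ereal_inf_lbound; exists z.
have s0 : 0 < s by apply: lt_le_trans (sub _ SZz0); rewrite lte_fin.
have i0 : 0 <= i.
  by apply: le_ereal_inf_tmp => _ [z SZz <-]; rewrite lee_fin f0.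
have ioo : i < +oo by apply: le_lt_trans (ilb _ SZz0) (ltry _).
have hi_s : hi x <= s.
  by apply/ess_supP; apply: filterS aeSZ => z SZz; rewrite pf// sub.
have i_lo : i <= lo x.
  by apply/ess_infP; apply: filterS aeSZ => z SZz; rewrite pf// ilb.
have [ieq0|ine0] := eqVneq i 0.
  by rewrite ieq0 inve0 gt0_muley// leey.
have i_gt0 : 0 < i by rewrite lt_neqAle eq_sym ine0.
have [soo|soo] := eqVneq s +oo.
  by rewrite soo gt0_mulye ?leey// inve_gt0// ?i_gt0// lt_eqF.
have lo0 := lt_le_trans i_gt0 i_lo.
have hioo : hi x < +oo by rewrite (le_lt_trans hi_s)// ltey.
have [loE hiE flo fle] := fin_lo_hi lo0 hioo.
have i_fin : i \is a fin_num by rewrite ge0_fin_numE.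
have s_fin : s \is a fin_num by rewrite ge0_fin_numE ?ltey// ltW.
rewrite /ess_log_osc lo0 hioo/=.
move: i_gt0 s0 hi_s i_lo; rewrite loE hiE -(fineK i_fin) -(fineK s_fin).
set i' := fine i; set s' := fine s; rewrite !lte_fin !lee_fin => i'0 s'0 hs il.
rewrite inver gt_eqF// -EFinM lne_EFin ?divr_gt0// lee_fin ln_div ?posrE//.
apply: lerB; rewrite /ln_ess_sup /ln_ess_inf ler_ln ?posrE//.
exact: lt_le_trans flo fle.
Qed.

End essential_bounds.

(** * Total variation *)

Lemma d_TV_ge0 {d : measure_display} {T : measurableType d} {R : realType}
  (P Q : probability T R) : 0 <= d_TV P Q.
Proof.
by rewrite /d_TV /abs_diff; apply: mule_ge0; rewrite ?lee_fin ?invr_ge0.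
Qed.

Section total_variation_density.
Context {d : measure_display} {T : measurableType d} {R : realType}.
Variables (P Q : probability T R) (r : T -> R).
Hypotheses (mr : measurable_fun [set: T] r) (r0 : forall x, (0 <= r x)%R)
  (PE : forall A, measurable A -> P A = \int[Q]_(x in A) (r x)%:E).

Let charge_diffE A : measurable A ->
  charge_diff P Q A = \int[Q]_(x in A) (r x - 1)%:E.
Proof.
move=> mA; rewrite integralB_EFin//; last 2 first.
- exact: (integrableS measurableT mA (@subsetT _ _)
    (density_integrable mr r0 PE)).
- exact: finite_measure_integrable_cst.
rewrite -PE// integral_cst// mul1e.
by rewrite -[LHS]/(P A + (-1)%:E * Q A) EFinN mulN1e.
Qed.

(* Witnessed by the set where r >= 1 and its complement. *)
Let charge_variation_ge (D N : set T)
    (hd : hahn_decomposition (charge_diff P Q) D N) :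
  \int[Q]_x (`|r x - 1|)%:E <= charge_variation hd [set: T].
Proof.
pose A := [set x | 1 <= r x]%R.
have mA : measurable A.
  by rewrite -[A]setTI; apply: measurable_fun_le.
have mnr : measurable_fun [set: T] (fun x => (`|r x - 1|)%:E).
  by apply/measurable_EFinP; apply: measurableT_comp => //; exact: measurable_funB.
have -> : charge_variation hd [set: T] = charge_variation hd A + charge_variation hd (~` A).
  rewrite -measureU ?setUv ?setICr//; exact: measurableC.
rewrite -(setUv A) ge0_integral_setU ?setUv//; last 2 first.
- exact: measurableC.
- exact/disj_setPCl.
apply: leeD.
  apply: le_trans (abse_charge_variation _ mA); rewrite charge_diffE//.
  rewrite (@eq_integral _ _ _ Q A (fun x => (r x - 1)%:E)) ?lee_abs// => x /set_mem Ax.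
  by rewrite ger0_norm// subr_ge0.
have mCA := measurableC mA.
apply: le_trans (abse_charge_variation _ mCA); rewrite charge_diffE//.
rewrite (@eq_integral _ _ _ Q (~` A) (fun x => - (`|r x - 1|)%:E) (fun x => (r x - 1)%:E)).
  by rewrite integral_ge0N ?abseN ?lee_abs// => x _; rewrite lee_fin.
move=> x /set_mem /= /negP; rewrite -ltNge => rx1.
by rewrite ltr0_norm ?subr_lt0// opprK.
Qed.

Lemma d_TV_density_ge : 2^-1%:E * \int[Q]_x (`|r x - 1|)%:E <= d_TV P Q.
Proof.
rewrite /d_TV; apply: lee_wpmul2l; first by rewrite lee_fin invr_ge0.
exact: charge_variation_ge.
Qed.

End total_variation_density.

(** * Proof of the bounds *)

Section conditional_density_ratio.
Context {d dX dZ : measure_display} {Omega : measurableType d}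
  {TX : measurableType dX} {TZ : measurableType dZ} {R : realType}.
Variables (P : probability Omega R) (X : {RV P >-> TX}) (Z : {RV P >-> TZ})
  (SX : set TX) (SZ : set TZ).
Hypotheses (mSX : measurable SX) (mSZ : measurable SZ)
  (XSX : forall w, SX (X w)) (ZSZ : forall w, SZ (Z w)).
Variables (nu : {measure set TZ -> \bar R}) (mu : {sigma_finite_measure set TZ -> \bar R})
  (k : TX -> probability TZ R) (p : TX -> TZ -> R).
Hypotheses (muE : forall A, mu A = nu (A `&` SZ))
  (hk : conditional_law X Z SX k) (hp : conditional_density SX SZ nu k p).
Local Notation PX := (distribution P X).
Local Notation Q := (distribution P Z).

(** Extension by 0, measurable and nonnegative on the whole product space. *)
Let p' : TX * TZ -> R := (fun xz => p xz.1 xz.2) \_ (SX `*` SZ).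

Let mp' : measurable_fun [set: TX * TZ] p'.
Proof.
have [mp _ _] := hp.
by apply: (measurable_restrictT _ (measurableX mSX mSZ)).1.
Qed.

Let p'0 xz : (0 <= p' xz)%R.
Proof.
have [_ p0 _] := hp; rewrite /p' patchE; case: ifPn => // /set_mem[]; exact: p0.
Qed.

Let kE x B : SX x -> measurable B -> k x B = \int[mu]_(z in B) (p' (x, z))%:E.
Proof.
have [_ _ kp] := hp => SXx mB; rewrite kp//.
rewrite (eq_measure_integral mu); last first.
  move=> A mA AB; rewrite -[RHS]/(mu A) muE; congr (nu _).
  by apply/esym/setIidPl => z /AB[].
rewrite integral_mkcondr; apply: eq_integral => z _.
by rewrite /p' !patchE in_setX/= (mem_set SXx)/=; case: ifPn.
Qed.

Let p'_out x z : ~ SX x -> p' (x, z) = 0%R.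
Proof.
by move=> xSX; rewrite /p' patchE in_setX/=; case: ifPn => // /andP[/set_mem].
Qed.

Let jointE A B : measurable A -> measurable B ->
  joint_law X Z (A `*` B) = \int[PX]_(x in A) \int[mu]_(z in B) (p' (x, z))%:E.
Proof.
move=> mA mB; have [_ kAB] := hk.
rewrite -[LHS]/(P (X @^-1` A `&` Z @^-1` B)) kAB//.
rewrite setIC integral_mkcondr; apply: eq_integral => x _.
rewrite patchE; case: ifPn => [/set_mem SXx|/negP xSX]; first exact: kE.
rewrite integral0_eq// => z _; rewrite p'_out// => SXx.
by apply: xSX; rewrite inE.
Qed.

Let QE B : measurable B -> Q B = \int[PX]_x \int[mu]_(z in B) (p' (x, z))%:E.
Proof.
move=> mB; rewrite -jointE// -[LHS]/(P (Z @^-1` B)) -[RHS]/(P (rv_pair X Z @^-1` _)).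
by congr (P _); apply/seteqP; split=> w //= [].
Qed.

Let r := density_ratio PX p'.
Let qr := mixture_density PX p'.

Let mr : measurable_fun [set: TX * TZ] r. Proof. exact: measurable_density_ratio. Qed.
Let r0 xz : (0 <= r xz)%R. Proof. exact: density_ratio_ge0. Qed.

Let aeSX : {ae PX, forall x, SX x}.
Proof.
exists (~` SX); split; [exact: measurableC| |by []].
rewrite -[LHS]/(P (X @^-1` (~` SX))) (_ : _ @^-1` _ = set0) ?measure0//.
by apply/seteqP; split => w //=; apply; exact: XSX.
Qed.

Let aeSZ : {ae Q, forall z, SZ z}.
Proof.
exists (~` SZ); split; [exact: measurableC| |by []].
rewrite -[LHS]/(P (Z @^-1` (~` SZ))) (_ : _ @^-1` _ = set0) ?measure0//.
by apply/seteqP; split => w //=; apply; exact: ZSZ.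
Qed.

Let kr : {ae PX, forall x, SX x /\ forall B, measurable B ->
  k x B = \int[Q]_(z in B) (r (x, z))%:E}.
Proof.
have := density_ratioE mp' p'0 QE; move: aeSX.
by apply: filterS2 => x SXx h; split=> // B mB; rewrite kE// h.
Qed.

Let marg1 : {ae PX, forall x, \int[Q]_z (r (x, z))%:E = 1}.
Proof.
by apply: filterS kr => x [_ h]; rewrite -h//; exact: probability_setT.
Qed.

Let marg2 : {ae Q, forall z, \int[PX]_x (r (x, z))%:E = 1}.
Proof. exact: density_ratio_marginal2 mp' p'0 QE. Qed.

Let joint_density C : measurable C ->
  joint_law X Z C = \int[product_law X Z]_(xz in C) (r xz)%:E.
Proof.
move=> mC; apply: (integral_density_product mr r0) => // A B mA mB.
rewrite jointE//; apply: ae_eq_integral => //.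
- by apply: measurable_funTS; exact: measurable_integral_section.
- by apply: measurable_funTS; exact: measurable_integral_section.
by apply: filterS (density_ratioE mp' p'0 QE) => x h _; exact: h.
Qed.

Let alpha := ln_ess_inf Q p'.
Let beta := ln_ess_sup Q p'.
Let osc := ess_log_osc Q p'.
Let b z := ln (qr z).

Let osc_le_gamma x : SX x -> osc x <= gamma SZ p x.
Proof.
have [_ p0 _] := hp => SXx; apply: ess_log_osc_le => //.
- by move=> z; exact: p0.
(* If [p x] vanished on all of [SZ], the probability [k x] would have total mass 0. *)
- apply: contrapT => no; have := kE SXx measurableT.
  rewrite integral0_eq => [|z _].
    by rewrite [LHS]probability_setT => /eqP; rewrite onee_eq0.
  rewrite /p' patchE in_setX/=; case: ifPn => // /andP[_ /set_mem SZz].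
  congr (_%:E); apply/eqP; rewrite eq_le p0// andbT leNgt.
  by apply/negP => pz; apply: no; exists z.
- by move=> z SZz; rewrite /p' patchE in_setX/= !mem_set.
Qed.

Let env : {ae PX, forall x, osc x < +oo} ->
  {ae PX, forall x, {ae Q, forall z, (0 < r (x, z))%R /\
    (alpha x <= ln (r (x, z)) + b z <= beta x)%R}}.
Proof.
apply: filterS => x /ess_log_osc_fin[_].
apply: filterS2 (mixture_density_gt0 mp' p'0 QE) => z qz [pz le_ln].
split; first by rewrite divr_gt0.
by rewrite /b /r /density_ratio ln_div ?posrE//= subrK.
Qed.

(** The change of variables is made on the measurable side; the comparison with [gamma] then takes
    place on [Omega]. *)
Let osc2_le : \int[PX]_x (osc x ^+ 2) <= \int[P]_w (gamma SZ p (X w) ^+ 2).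
Proof.
have osc0 x : 0 <= osc x by exact: ess_log_osc_ge0.
have mosc : measurable_fun [set: TX] osc by exact: measurable_ess_log_osc.
rewrite ge0_integral_distribution//; last 2 first.
- by under eq_fun do rewrite expe2; exact: emeasurable_funM.
- by move=> x; exact: expe_ge0.
apply: ge0_le_integral_any => w _; first exact: (expe_ge0 2 (osc0 (X w))).
by apply: lee_pmul => //; exact: osc_le_gamma.
Qed.

Let MI := mutual_information X Z.
Let LI := lautum_information X Z.
Let G := \int[P]_w (gamma SZ p (X w) ^+ 2).

Let IE : MI = \int[PX \x Q]_xz (r xz * ln (r xz))%:E.
Proof. exact: kl_divergence_density mr r0 joint_density. Qed.

Let LE : LI < +oo -> {ae PX \x Q, forall xz, (0 < r xz)%R} /\
  LI = \int[PX \x Q]_xz (- ln (r xz))%:E.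
Proof. exact: kl_divergence_density_rev mr r0 joint_density. Qed.

Let G_finite : G < +oo -> {ae PX, forall x, osc x < +oo} /\
   \int[PX]_x ((beta x - alpha x) ^+ 2)%:E <= G.
Proof.
have osc0 x : 0 <= osc x by exact: ess_log_osc_ge0.
have mosc : measurable_fun [set: TX] osc by exact: measurable_ess_log_osc.
have mosc2 : measurable_fun [set: TX] (fun x => osc x ^+ 2).
  by under eq_fun do rewrite expe2; exact: emeasurable_funM.
move=> Goo; have osc_lty : {ae PX, forall x, osc x < +oo}.
  have iosc : PX.-integrable [set: TX] (fun x => osc x ^+ 2).
    apply/integrableP; split => //.
    under eq_integral do rewrite gee0_abs ?expe_ge0//.
    exact: le_lt_trans osc2_le Goo.
  apply: filterS (integrable_ae measurableT iosc) => x /(_ I).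
  by have := osc0 x; case: (osc x) => [y _ _| |]//; exact: ltry.
split=> //; apply: le_trans osc2_le; rewrite le_eqVlt; apply/orP; left; apply/eqP.
apply: ae_eq_integral => //.
  apply/measurable_EFinP/measurable_funX/measurable_funB.
    exact: measurable_ln_ess_sup.
  exact: measurable_ln_ess_inf.
by apply: filterS osc_lty => x /ess_log_osc_fin[oscE _] _; rewrite [osc x]oscE.
Qed.

Let malpha : measurable_fun [set: TX] alpha.
Proof. exact: measurable_ln_ess_inf. Qed.

Let mbeta : measurable_fun [set: TX] beta.
Proof. exact: measurable_ln_ess_sup. Qed.

Let mb : measurable_fun [set: TZ] b.
Proof.
apply: measurableT_comp (@measurable_ln R) _.
exact: measurable_mixture_density.
Qed.

Let G_ge0 : 0 <= G.
Proof.
apply: integral_ge0 => w _; apply: expe_ge0.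
exact: le_trans (ess_log_osc_ge0 _ _ _) (osc_le_gamma (XSX w)).
Qed.

Lemma mutual_information_le_half_sqr : MI <= (2^-1)%:E * G.
Proof.
have [Goo|] := ltP G +oo; last first.
  by rewrite leye_eq => /eqP ->; rewrite gt0_muley ?leey// lte_fin invr_gt0.
have [osc_fin le_G] := G_finite Goo.
rewrite IE; apply: le_trans (lee_wpmul2l _ le_G); last by rewrite lee_fin invr_ge0.
apply: (integral_xlnx_le_half_sqr mr r0 marg1 marg2 malpha mbeta mb (env osc_fin)).
exact: le_lt_trans le_G Goo.
Qed.

Lemma mutual_information_le_sqrt : MI <= ((2^-1)%:E * G * LI) `^ (2^-1).
Proof.
have half0 : 0 < (2^-1 : R)%:E by rewrite lte_fin invr_gt0.
have halfN0 : (2^-1 != 0 :> R)%R by rewrite invr_neq0.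
have [Loo|] := ltP LI +oo; last first.
  (* For [G = 0] the product with [+oo] is 0, and the bound follows from the other one. *)
  rewrite leye_eq => /eqP ->; have [G0|GN0] := eqVneq G 0.
    by have := mutual_information_le_half_sqr; rewrite G0 !mule0 mul0e poweR0r.
  rewrite gt0_muley ?poweRyr ?leey// mule_gt0// lt_neqAle eq_sym GN0.
  exact: G_ge0.
have [r_gt0 LE'] := LE Loo.
have L0 : 0 <= LI by rewrite LE'; apply: integral_neg_ln_ge0 => //; rewrite -LE'.
have [Goo|] := ltP G +oo; last first.
  rewrite leye_eq => /eqP ->; rewrite (gt0_muley half0).
  (* For [LI = 0] the right-hand side is again 0; then [r = 1] almost everywhere and the mutual
     information is 0. *)
  have [Leq0|LN0] := eqVneq LI 0; last first.
    by rewrite gt0_mulye ?poweRyr ?leey// lt_neqAle eq_sym LN0.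
  have r1 : {ae PX \x Q, forall xz, r xz = 1%R}.
    by apply: density1_of_integral_neg_ln => //; rewrite -LE'.
  by rewrite IE xlnx_eq0_of_density1// poweR_ge0.
have [osc_fin le_G] := G_finite Goo.
rewrite IE LE'; apply: le_trans (integral_xlnx_le_sqrt mr r0 marg1 marg2 malpha
  mbeta mb (env osc_fin) (le_lt_trans le_G Goo) r_gt0 _) _; first by rewrite -LE'.
apply: gt0_ler_poweR; rewrite ?invr_ge0 ?in_itv/= ?leey ?andbT//.
- rewrite !mule_ge0 ?(ltW half0) -?LE'//.
  by apply: integral_ge0 => x _; rewrite lee_fin sqr_ge0.
- by rewrite !mule_ge0 ?(ltW half0) -?LE'//; exact: G_ge0.
- by rewrite -LE'; apply: lee_wpmul2r => //; apply: lee_wpmul2l.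
Qed.

Lemma mutual_information_le_TV :
  MI <= ereal_sup [set gamma SZ p x | x in SX] * \int[PX]_(x in SX) d_TV (k x) Q.
Proof.
set S := ereal_sup _; set T := \int[PX]_(x in SX) _.
pose W := \int[PX \x Q]_xz (`|r xz - 1|)%:E.
have mnr : measurable_fun [set: TX * TZ] (fun xz => (`|r xz - 1|)%:E).
  by apply/measurable_EFinP; apply: measurableT_comp => //; exact: measurable_funB.
have nr0 (xz : TX * TZ) : 0 <= (`|r xz - 1|)%:E by rewrite lee_fin.
have half0 : 0 <= (2^-1 : R)%:E by rewrite lee_fin invr_ge0.
have W0 : 0 <= W by exact: integral_ge0.
have W_le_T : (2^-1)%:E * W <= T.
  pose F x := \int[Q]_z (`|r (x, z) - 1|)%:E.
  have F0 x : 0 <= F x by exact: integral_ge0.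
  have mF : measurable_fun [set: TX] F.
    exact: (measurable_fun_fubini_tonelli_F (m2 := Q) _ mnr nr0).
  have hF0 x : 0 <= (2^-1)%:E * F x by rewrite mule_ge0.
  have mhF : measurable_fun [set: TX] (fun x => (2^-1)%:E * F x).
    exact: measurable_funeM.
  rewrite /W fubini_tonelli1// -[X in _ * X]/(\int[PX]_x F x).
  rewrite -(ge0_integralZl _ measurableT mF (fun x _ => F0 x) half0).
  (* Measurability of [d_TV (k x) Q] in [x] is not at hand, so the measurable side is restricted to
     the complement of the null set [N], where the comparison is pointwise. *)
  have [N [mN N0 krN]] := kr.
  rewrite (ge0_negligible_integral mN measurableT mhF _ N0)//.
  rewrite /T [leLHS]integral_mkcond [leRHS]integral_mkcond.
  apply: ge0_le_integral_any => x _.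
    by rewrite patchE; case: ifPn.
  rewrite !patchE; case: ifPn => [/set_mem[_ xN]|_]; last first.
    by case: ifPn => // _; exact: d_TV_ge0.
  have [SXx kxr] : SX x /\ forall B, measurable B ->
      k x B = \int[Q]_(z in B) (r (x, z))%:E.
    by apply: contrapT => /krN.
  rewrite mem_set//; apply: d_TV_density_ge => //.
  exact: measurableT_comp mr (pair1_measurable x).
(* A point of [Omega] gives a point of [SX], without which the supremum [S] would be [-oo]. *)
have [w0 _] : exists w : Omega, True.
  apply: contrapT => /forallNP no; have := probability_setT P.
  rewrite (_ : [set: Omega] = set0) ?measure0; last first.
    by apply/seteqP; split=> // w; have := no w.
  by move=> /eqP; rewrite eq_sym onee_eq0.
have gS x : SX x -> osc x <= S.
  move=> SXx; apply: le_trans (osc_le_gamma SXx) _.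
  by apply: ereal_sup_ubound; exists x.
have S0 : 0 <= S by apply: le_trans (ess_log_osc_ge0 _ _ _) (gS _ (XSX w0)).
have T0 : 0 <= T by apply: le_trans W_le_T; rewrite mule_ge0.
(* Treated apart because [S] may be [+oo]: the right-hand side is then 0, and [r = 1] almost
   everywhere. *)
have [Teq0|TN0] := eqVneq T 0.
  have Weq0 : W = 0.
    apply/eqP; rewrite eq_le W0 andbT leNgt; apply/negP => W_gt0.
    by move: W_le_T; rewrite Teq0 leNgt mule_gt0// lte_fin invr_gt0.
  rewrite Teq0 mule0 IE xlnx_eq0_of_density1//.
  exact: density1_of_integral_subr1.
have [Soo|] := ltP S +oo; last first.
  by rewrite leye_eq => /eqP ->; rewrite gt0_mulye ?leey// lt_neqAle eq_sym TN0.
have S_fin : S \is a fin_num by rewrite ge0_fin_numE.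
have osc_fin : {ae PX, forall x, osc x < +oo}.
  by apply: filterS aeSX => x /gS oscS; exact: le_lt_trans oscS Soo.
rewrite IE; apply: le_trans (integral_xlnx_le_bounded mr r0 marg1 marg2 malpha
  mbeta mb (env osc_fin) (fine_ge0 S0) _) _; last first.
  by rewrite fineK//; apply: lee_wpmul2l.
move: osc_fin aeSX; apply: filterS2 => x /ess_log_osc_fin[oscE _] /gS.
have := ess_log_osc_ge0 Q p' x; rewrite -/osc [osc x]oscE -(fineK S_fin) !lee_fin.
by move=> osc0; rewrite ger0_norm.
Qed.

End conditional_density_ratio.

Theorem corollary12 (R : realType)
    (d dX dZ : measure_display) (Omega : measurableType d)
    (TX : measurableType dX) (TZ : measurableType dZ)
    (P : probability Omega R) (X : {RV P >-> TX}) (Z : {RV P >-> TZ})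
    (SX : set TX) (SZ : set TZ)
    (mSX : measurable SX) (mSZ : measurable SZ)
    (XSX : forall w, SX (X w)) (ZSZ : forall w, SZ (Z w))
    (nu : {measure set TZ -> \bar R}) (nu_sfin : sigma_finite SZ nu)
    (k : TX -> probability TZ R) (hk : conditional_law X Z SX k)
    (p : TX -> TZ -> R) (hp : conditional_density SX SZ nu k p) :
  (mutual_information X Z <=
    mine (((2^-1)%:E * (\int[P]_w (gamma SZ p (X w) ^+ 2))
             * lautum_information X Z) `^ (2^-1))
         ((2^-1)%:E * \int[P]_w (gamma SZ p (X w) ^+ 2))) /\
  (mutual_information X Z <=
    ereal_sup [set gamma SZ p x | x in SX] *
    \int[distribution P X]_(x in SX) d_TV (k x) (distribution P Z)).
Proof.
have [mu muE] := sigma_finite_restriction mSZ nu_sfin.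
split; last exact: (mutual_information_le_TV mSX mSZ XSX ZSZ muE hk hp).
rewrite le_min; apply/andP; split.
  exact: (mutual_information_le_sqrt mSX mSZ XSX ZSZ muE hk hp).
exact: (mutual_information_le_half_sqr mSX mSZ XSX ZSZ muE hk hp).
Qed.
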